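(* Let $p\ge2$, let $U\subset\mathbb{C}$ be a bounded domain with $0\in U$, and let $\pi$ be a coupling of two copies $(\xi,\theta)$ and $(\xi',\theta')$ of the exit pair from $U$, i.e. $\pi\in\Pi(\mu_U,\mu_U)$. For $\lambda>0$ set $$T_p^\pi(\lambda)=\left(\mathbf{E}_\pi\left(|\xi-\lambda\xi'|^p+|\theta-\lambda^2\theta'|^{p/2}\right)\right)^{1/p}.$$ Then $T_p^\pi(\lambda)$ admits a complete asymptotic expansion in powers of $\lambda^{-1}$. More precisely, there exist constants $b_0^\pi,b_1^\pi,b_2^\pi,\ldots$ such that, for every integer $N\ge0$, $$T_p^\pi(\lambda)=\lambda S_p^{1/p}+b_0^\pi+\sum_{j=1}^N b_j^\pi\lambda^{-j}+O(\lambda^{-N-1})\qquad(\lambda\to\infty).$$ The first correction is $$b_0^\pi=-\frac{\mathbf{E}_\pi\left(|\xi'|^{p-2}\,\xi'\cdot\xi\right)}{S_p^{(p-1)/p}},$$ where $\xi'\cdot\xi=\Re(\xi'\overline{\xi})$. In particular, $$T_p^\pi(\lambda)=\lambda S_p^{1/p}-\frac{\mathbf{E}_\pi\left(|\xi'|^{p-2}\,\xi'\cdot\xi\right)}{S_p^{(p-1)/p}}+O(\lambda^{-1})\qquad(\lambda\to\infty).$$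
   Context: A domain is a nonempty connected open proper subset of $\mathbb{C}$. $(Z_t)_{t\ge0}$ is a standard planar Brownian motion started at $0$ (independent standard one-dimensional Brownian motions as real and imaginary parts), $\tau_U:=\inf\{t\ge0:Z_t\notin U\}$, and $\mu_U$ is the joint law of the exit pair $(Z_{\tau_U},\tau_U)$ on $\mathbb{C}\times[0,\infty)$. $\Pi(\mu,\nu)$ is the set of probability measures with marginals $\mu$ and $\nu$; $\mathbf{E}_\pi$ is expectation when $((\xi,\theta),(\xi',\theta'))$ has law $\pi$. The coupling $\pi$ does not depend on $\lambda$; by Brownian scaling $(\lambda\xi',\lambda^2\theta')$ has the law of the exit pair from $\lambda U=\{\lambda z:z\in U\}$, so $T_p^\pi(\lambda)$ is the transport cost of the corresponding coupling of $\mu_U$ and $\mu_{\lambda U}$. $S_p:=\mathbf{E}(|Z_{\tau_U}|^p)+\mathbf{E}(\tau_U^{p/2})$. *)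

(* Defs.v *)
From HB Require Import structures.
From mathcomp Require Import all_boot all_order all_algebra.
From mathcomp Require Import complex.
From mathcomp Require Import all_classical all_reals all_analysis.

Set Implicit Arguments.
Unset Strict Implicit.
Unset Printing Implicit Defensive.

Import Order.TTheory GRing.Theory Num.Theory.
Import numFieldNormedType.Exports.

Local Open Scope classical_set_scope.
Local Open Scope ring_scope.
Local Open Scope complex_scope.

(* The topology of R[i] as a numFieldType, given by its modulus. *)
HB.instance Definition _ (R : rcfType) := NormedModule.copy R[i] R[i]^o.

(* The complex plane with the Borel sigma-algebra of its topology; as a type it
   is convertible to R[i]. *)
Definition borelC (R : realType) := g_sigma_algebraType (@open R[i]).

(* The Euclidean scalar product of the plane *)
Definition cdot (R : realType) (z w : R[i]) : R := complex.Re (z * w^*).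

Definition domain (R : realType) (U : set R[i]) : Prop :=
  [/\ U !=set0, connected U, open U & U <> setT].

(* Below, Normc.normc z is the modulus of z : R[i] as an element of R, whereas
   the norm `|z| of R[i] has its values in R[i]. *)

Section probability_notions.
Context (R : realType) (d : measure_display) (T : measurableType d).
Variable P : probability T R.

Definition mutually_independent (n : nat) (X : 'I_n -> T -> R) : Prop :=
  forall A : 'I_n -> set R, (forall i, measurable (A i)) ->
    P (\bigcap_i (X i @^-1` A i)) = (\prod_(i < n) P (X i @^-1` A i))%E.

(* A process is a family indexed by R, of which only the members with
   nonnegative index are ever used. *)
Definition process_sigma (X : R -> {RV P >-> R}) : set_system T :=
  <<s [set E | exists t, exists A : set R,
         [/\ 0 <= t, measurable A & E = X t @^-1` A]] >>.

Definition independent_processes (X Y : R -> {RV P >-> R}) : Prop :=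
  forall E F, process_sigma X E -> process_sigma Y F ->
    P (E `&` F) = (P E * P F)%E.

(* The second parameter of normal_prob is the standard deviation. *)
Definition standard_BM (B : R -> {RV P >-> R}) : Prop :=
  [/\ forall w, B 0 w = 0,
      forall w, {within `[0, +oo[, continuous (fun t => B t w)},
      forall s t, 0 <= s -> s < t -> forall A : set R, measurable A ->
        P ((fun w => B t w - B s w) @^-1` A)
        = normal_prob 0 (Num.sqrt (t - s)) A
    & forall (n : nat) (t : nat -> R),
        0 <= t 0%N -> (forall i, t i <= t i.+1) ->
        mutually_independent
          (fun (i : 'I_n) w => B (t i.+1) w - B (t i) w)].

Definition planar_BM (Z : R -> T -> R[i]) : Prop :=
  exists X Y : R -> {RV P >-> R},
    [/\ standard_BM X, standard_BM Y, independent_processes X Y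
      & forall t w, 0 <= t -> Z t w = X t w +i* Y t w].

Definition exit_time (Z : R -> T -> R[i]) (U : set R[i]) (w : T) : \bar R :=
  ereal_inf [set t%:E | t in [set t : R | 0 <= t /\ ~ U (Z t w)]].

(* On the event that the exit time is +oo, which is null for planar Brownian
   motion in a bounded set, fine makes this the pair (Z_0, 0). *)
Definition exit_pair (Z : R -> T -> R[i]) (U : set R[i]) (w : T)
    : borelC R * R :=
  (Z (fine (exit_time Z U w)) w, fine (exit_time Z U w)).

(* The law of the exit pair *)
Definition exit_law (Z : R -> T -> R[i]) (U : set R[i])
    : set (borelC R * R) -> \bar R :=
  pushforward P (exit_pair Z U).

(* The constant S_p *)
Definition exit_moment (Z : R -> T -> R[i]) (U : set R[i]) (p : R) : R :=
  fine ('E_P[fun w => (Normc.normc (exit_pair Z U w).1 `^ p)%R]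
        + 'E_P[fun w => ((exit_pair Z U w).2 `^ (p / 2))%R])%E.

End probability_notions.

(* The set of couplings Pi(mu, nu) *)
Definition couplings (R : realType) (d1 d2 : measure_display)
    (T1 : measurableType d1) (T2 : measurableType d2)
    (mu : set T1 -> \bar R) (nu : set T2 -> \bar R)
    : set (probability (T1 * T2)%type R) :=
  [set pi | (forall A, measurable A -> pushforward pi fst A = mu A)
         /\ (forall A, measurable A -> pushforward pi snd A = nu A)].

Section transport.
Context (R : realType).
Variable pi : probability ((borelC R * R) * (borelC R * R))%type R.

(* Points of the product space are ((xi, theta), (xi', theta')). *)

(* The transport cost T_p^pi(lambda) *)
Definition transport (p lambda : R) : R :=
  fine 'E_pi[fun w => Normc.normc ((w.1.1 : R[i]) - lambda%:C * w.2.1) `^ p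
                      + `|w.1.2 - lambda ^+ 2 * w.2.2| `^ (p / 2)] `^ p^-1.

(* E_pi (|xi'|^(p-2) xi'.xi) *)
Definition correlation (p : R) : R :=
  fine 'E_pi[fun w => Normc.normc w.2.1 `^ (p - 2) * cdot w.2.1 w.1.1].

End transport.

(* f(x) = O(g(x)) as x tends to +oo; the notation =O_F of the library expects a
   bundled filter, which +oo is not. *)
Definition bigO_pinfty (R : realType) (f g : R -> R) : Prop :=
  exists C : R, \forall x \near +oo, `|f x| <= C * `|g x|.

(* Main.v *)
Require Import Defs.
From HB Require Import structures.
From mathcomp Require Import all_boot all_order all_algebra.
From mathcomp Require Import complex.
From mathcomp Require Import all_classical all_reals all_analysis.
From mathcomp Require Import measurable_realfun.
From mathcomp Require Import ring lra.

(** With e = 1 / lambda and q = p / 2, off a null set,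

      |xi - lambda xi'|^p + |theta - lambda^2 theta'|^q
        = lambda^p (|xi'|^p |1 + a e + b e^2|^q + theta'^q |1 + b' e^2|^q),

    where a = - 2 xi'.xi / |xi'|^2, b = |xi|^2 / |xi'|^2 and
    b' = - theta / theta'. Hence T_p(lambda) = lambda F(e)^(1/p), where F(e) is
    a sum of two expectations of the form E(h |1 + a e + b e^2|^q), and it is
    enough to expand F in powers of e at 0+: since F(0) = S_p > 0, the
    binomial expansion of x^(1/p) at S_p then expands F^(1/p).

    For every real u and every n, |1 + u|^q differs from its binomial
    polynomial of degree n - 1 by at most C (|u|^n + |u|^m) for some m >= n
    (binomial_taylor_global). With u = a e + b e^2 this gives an
    expansion of E(h |1 + a e + b e^2|^q) to all orders as soon as all the
    mixed moments E(h |a|^i |b|^j) are finite (expectation_taylor); its first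
    two coefficients are E(h) and q E(h a). The first summand contributes
    - p E(|xi'|^(p-2) xi'.xi) to the coefficient of e, the second one nothing,
    whence the value of b_0.

    The mixed moments are finite because |xi| and |xi'| lie between two
    positive constants (U is bounded and contains a neighbourhood of 0) and
    because the exit time and its inverse have moments of all orders
    (exit_time_fast_tail, inv_exit_time_fast_tail, fast_tail_moment). Large
    exit times are exponentially unlikely since the unit increments of the
    real part are independent and stay bounded before the exit. Small exit
    times are less likely than any power: by dyadic chaining and the Gaussian
    tail, the path leaves a fixed neighbourhood of 0 before time s with
    probability O(s^m) for every m (brownian_sup_tail).

    The marginals of the coupling are image measures under the exit pair, so
    its measurability is needed to transfer all this to the coupling: on the
    event that the path stays in the open set U during [0, s] it stays, by
    compactness, at distance at least 1 / n from the complement for some n,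
    which can be tested at countably many times (stays_inE). *)

Set Implicit Arguments.
Unset Strict Implicit.
Unset Printing Implicit Defensive.

Import Order.TTheory GRing.Theory Num.Theory.
Import numFieldNormedType.Exports.

Local Open Scope classical_set_scope.
Local Open Scope ring_scope.

(** * The binomial expansion and polynomial expansions at 0+ *)

(** The generalized binomial coefficient s (s - 1) ... (s - k + 1) / k!. *)
Fixpoint gbinom {R : realType} (s : R) (k : nat) : R :=
  if k is k'.+1 then s / k%:R * gbinom (s - 1) k' else 1.

(** The sum of the terms of degree < n of the binomial series of (1 + X)^s. *)
Definition binpoly {R : realType} (s : R) (n : nat) : {poly R} :=
  \poly_(k < n) gbinom s k.

Lemma deriv_binpoly {R : realType} (s : R) n :
  (binpoly s n.+1)^`() = s *: binpoly (s - 1) n.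
Proof.
apply/polyP => k; rewrite coef_deriv coefZ !coef_poly ltnS.
case: ifP => _; last by rewrite mul0rn mulr0.
by rewrite -mulr_natr /= mulrAC divfK ?pnatr_eq0.
Qed.

Lemma powR_1D_le {R : realType} (s u : R) : `|u| <= 2^-1 ->
  (1 + u) `^ s <= expR (`|s| * ln 2).
Proof.
rewrite ler_norml => /andP[u1 u2].
have v0 : 0 < 1 + u by lra.
rewrite /powR gt_eqF// ler_expR (le_trans (ler_norm _))// normrM ler_wpM2l//.
rewrite ler_norml -lnV ?posrE//; apply/andP; split; rewrite ler_ln ?posrE ?invr_gt0//;
  lra.
Qed.

(** By induction on n for all real s at once: the derivative of the remainder of
    order n + 1 for s is s times the remainder of order n for s - 1. The bound on
    u keeps 1 + u away from 0. *)
Lemma binomial_taylor {R : realType} n (s : R) :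
  exists2 C : R, 0 <= C & forall u : R, `|u| <= 2^-1 ->
    `|(1 + u) `^ s - (binpoly s n).[u]| <= C * `|u| ^+ n.
Proof.
elim: n s => [|n IH] s.
  exists (expR (`|s| * ln 2)) => [|u hu]; first exact: expR_ge0.
  rewrite /binpoly poly_def big_ord0 horner0 subr0 expr0 mulr1.
  by rewrite ger0_norm ?powR_ge0// powR_1D_le.
have [C C0 hC] := IH (s - 1).
exists (`|s| * C) => [|u hu]; first by rewrite mulr_ge0.
pose f v := (1 + v) `^ s - (binpoly s n.+1).[v].
pose df v := s * ((1 + v) `^ (s - 1) - (binpoly (s - 1) n).[v]).
have dfP (v : R) : `|v| <= 2^-1 -> is_derive v 1 f (df v).
  move=> hv.
  have v1 : 0 < 1 + v by move: hv; rewrite ler_norml; lra.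
  have := is_derive_poly (binpoly s n.+1) v.
  rewrite deriv_binpoly hornerZ => H1.
  have H2 : is_derive v 1 (fun v => (1 + v) `^ s) (s * (1 + v) `^ (s - 1)).
    have H3 : is_derive v (1:R) (fun x : R => 1 + x) (0 + 1).
      exact: is_deriveD.
    have := is_derive1_comp (f := fun x => x `^ s) (is_derive1_powR s v1) H3.
    by rewrite add0r mulr1.
  rewrite /f /df mulrBr.
  exact: is_deriveB.
have f0 : f 0 = 0.
  by rewrite /f addr0 powR1 horner_coef0 coef_poly /= subrr.
have key c : `|c| <= `|u| -> `|df c| <= `|s| * C * `|u| ^+ n.
  move=> cu; rewrite /df normrM -mulrA ler_wpM2l//.
  rewrite (le_trans (hC c _)) ?(le_trans cu)// ler_wpM2l//.
  by rewrite lerXn2r// nnegrE.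
rewrite -/(f u) -[f u]subr0 -f0 exprS mulrCA mulrC.
have [u0|u0] := leP 0 u.
  have [x||c + ->] := @MVT_segment R f df 0 u u0.
  - rewrite in_itv/= => /andP[x0 xu]; apply: dfP.
    by rewrite ger0_norm ?ltW//; move: hu; rewrite ger0_norm//; lra.
  - apply: derivable_within_continuous => x; rewrite in_itv/= => /andP[x0 xu].
    by apply: ex_derive; apply: dfP; rewrite ger0_norm//; move: hu;
      rewrite ger0_norm//; lra.
  rewrite in_itv/= => /andP[c0 cu]; rewrite normrM subr0 ler_wpM2r//.
  by apply: key; rewrite !ger0_norm.
have [x||c + ] := @MVT_segment R f df u 0 (ltW u0).
- rewrite in_itv/= => /andP[x0 xu]; apply: dfP.
  by rewrite ltr0_norm//; move: hu; rewrite ltr0_norm//; lra.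
- apply: derivable_within_continuous => x; rewrite in_itv/= => /andP[x0 xu].
  by apply: ex_derive; apply: dfP; rewrite ler0_norm//; move: hu; rewrite ltr0_norm//;
    lra.
rewrite in_itv/= distrC => /andP[c0 cu] ->; rewrite normrM sub0r normrN ler_wpM2r//.
by apply: key; rewrite ler0_norm// ltr0_norm// lerN2.
Qed.

Lemma norm_horner_le {R : realType} (P : {poly R}) (x B : R) m :
  1 <= B -> `|x| <= B -> (size P <= m)%N ->
  `|P.[x]| <= (\sum_(k < size P) `|P`_k|) * B ^+ m.
Proof.
move=> B1 xB Pm; rewrite horner_coef mulr_suml (le_trans (ler_norm_sum _ _ _))//.
apply: ler_sum => k _; rewrite normrM ler_wpM2l// normrX.
rewrite (@le_trans _ _ (B ^+ k))//; first by rewrite lerXn2r// nnegrE (le_trans _ B1).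
by rewrite ler_weXn2l// (leq_trans _ Pm)// ltnW.
Qed.

(** For s >= 0 the remainder is controlled on the whole line: for |u| > 1/2 all
    the terms involved are dominated by one large power of |u|. *)
Lemma binomial_taylor_global {R : realType} n (s : R) : 0 <= s ->
  exists C : R, exists m : nat, 0 <= C /\ (n <= m)%N /\ forall u : R,
    `| `|1 + u| `^ s - (binpoly s n).[u]| <= C * (`|u| ^+ n + `|u| ^+ m).
Proof.
move=> s0; have [C C0 hC] := binomial_taylor n s.
pose m := maxn n (Num.truncn s).+1.
have nm : (n <= m)%N by rewrite leq_maxl.
have sm : s <= m%:R.
  by rewrite (le_trans (ltW (truncnS_gt s)))// ler_nat leq_maxr.
pose D := \sum_(k < size (binpoly s n)) `|(binpoly s n)`_k|.
have D0 : 0 <= D by apply: sumr_ge0.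
exists (C + (3 ^+ m + D * 2 ^+ m)), m; split; first by rewrite !addr_ge0 ?mulr_ge0.
split=> // u.
have [u1|u1] := leP `|u| 2^-1.
  have -> : `|1 + u| = 1 + u by rewrite ger0_norm//; move: u1; rewrite ler_norml; lra.
  rewrite (le_trans (hC u u1))// mulrDl ler_wpDr//.
    by rewrite mulr_ge0 ?addr_ge0 ?mulr_ge0.
  by rewrite ler_wpM2l// lerDl.
have u2 : 1 <= 2 * `|u| by lra.
have H1 : `|1 + u| `^ s <= 3 ^+ m * `|u| ^+ m.
  rewrite -exprMn (@le_trans _ _ ((1 + `|u|) `^ s))//.
    by rewrite ge0_ler_powR ?nnegrE ?addr_ge0// (le_trans (ler_normD _ _))// normr1.
  rewrite (@le_trans _ _ ((1 + `|u|) ^+ m))//; last first.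
    by rewrite lerXn2r ?nnegrE//; lra.
  by rewrite -powR_mulrn ?addr_ge0// ler_powR// lerDl.
have H2 : `|(binpoly s n).[u]| <= D * 2 ^+ m * `|u| ^+ m.
  rewrite -mulrA -exprMn norm_horner_le//; first lra.
  exact: leq_trans (size_poly _ _) nm.
rewrite (le_trans (ler_normB _ _))//.
rewrite [`|(`|_| `^ _)|]ger0_norm ?powR_ge0//.
rewrite (le_trans (lerD H1 H2))// -mulrDl.
rewrite (@le_trans _ _ ((3 ^+ m + D * 2 ^+ m) * (`|u| ^+ n + `|u| ^+ m)))//.
  by rewrite ler_wpM2l ?lerDr// addr_ge0// mulr_ge0.
by rewrite ler_wpM2r ?addr_ge0// lerDr.
Qed.

(** f e = P.[e] + O(e^n) as e tends to 0 from the right. P is any polynomial,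
    possibly of degree >= n: only its coefficients of degree < n matter. *)
Definition expands {R : realType} (n : nat) (f : R -> R) (P : {poly R}) : Prop :=
  exists2 C : R, 0 <= C & \forall e \near 0^'+, `|f e - P.[e]| <= C * e ^+ n.

Lemma near_right0_01 {R : realType} (d : R) : 0 < d ->
  \forall e \near (0:R)^'+, [/\ 0 < e, e <= 1 & e <= d].
Proof.
move=> d0; near=> e; split; near: e; first exact: nbhs_right_gt.
  exact: nbhs_right_le.
exact: nbhs_right_le.
Unshelve. all: by end_near. Qed.

Lemma horner_bounded {R : realType} (P : {poly R}) :
  exists2 C : R, 0 <= C & forall e : R, 0 <= e <= 1 -> `|P.[e]| <= C.
Proof.
exists (\sum_(k < size P) `|P`_k|) => [|e /andP[e0 e1]]; first exact: sumr_ge0.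
rewrite -[leRHS]mulr1 -(expr1n _ (size P)).
by rewrite norm_horner_le// ger0_norm.
Qed.

Lemma expands_near {R : realType} n (f g : R -> R) P :
  (\forall e \near 0^'+, f e = g e) -> expands n f P -> expands n g P.
Proof.
by move=> fg [C C0 hC]; exists C => //; near=> e; rewrite -(near fg e)//; near: e.
Unshelve. all: by end_near. Qed.

Lemma expands_horner {R : realType} n (P : {poly R}) : expands n (horner P) P.
Proof.
by exists 0 => //; near=> e; rewrite subrr normr0 mul0r.
Unshelve. all: by end_near. Qed.

Lemma expandsD {R : realType} n (f g : R -> R) P Q :
  expands n f P -> expands n g Q -> expands n (fun e => f e + g e) (P + Q).
Proof.
move=> [C C0 hC] [D D0 hD]; exists (C + D); first exact: addr_ge0.
near=> e; rewrite hornerD opprD addrACA mulrDl (le_trans (ler_normD _ _))// lerD//.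
- by near: e.
- by near: e.
Unshelve. all: by end_near. Qed.

Lemma expandsM {R : realType} n (f g : R -> R) P Q :
  expands n f P -> expands n g Q -> expands n (fun e => f e * g e) (P * Q).
Proof.
move=> [C C0 hC] [D D0 hD].
have [A A0 hA] := horner_bounded P.
have [B B0 hB] := horner_bounded Q.
exists (C * (B + D) + A * D); first by rewrite addr_ge0 ?mulr_ge0 ?addr_ge0.
near=> e.
have [e0 e1 _] : [/\ 0 < e, e <= 1 & e <= 1].
  by near: e; exact: near_right0_01.
have en : e ^+ n <= 1 by rewrite exprn_ile1// ltW.
have en0 : 0 <= e ^+ n by rewrite exprn_ge0// ltW.
have Hf : `|f e - P.[e]| <= C * e ^+ n by near: e.
have Hg : `|g e - Q.[e]| <= D * e ^+ n by near: e.
have HP : `|P.[e]| <= A by rewrite hA// !ltW.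
have HQ : `|Q.[e]| <= B by rewrite hB// !ltW.
have Hg' : `|g e| <= B + D.
  rewrite -(subrK Q.[e] (g e)) addrC (le_trans (ler_normD _ _))// lerD//.
  by rewrite (le_trans Hg)// ler_piMr.
rewrite hornerM.
have -> : f e * g e - P.[e] * Q.[e] = (f e - P.[e]) * g e + P.[e] * (g e - Q.[e]) by ring.
rewrite (le_trans (ler_normD _ _))// !normrM mulrDl lerD//.
  by rewrite mulrAC ler_pM.
by rewrite -mulrA ler_pM.
Unshelve. all: by end_near. Qed.

Lemma expandsZ {R : realType} n (f : R -> R) P k :
  expands n f P -> expands n (fun e => k * f e) (k *: P).
Proof.
move=> fP; rewrite -mul_polyC; apply: expands_near;
  last exact: expandsM (expands_horner n k%:P) fP.
by near=> e; rewrite /= hornerC.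
Unshelve. all: by end_near. Qed.

Lemma expands_comp {R : realType} n (f : R -> R) P Q :
  expands n f P -> expands n (fun e => Q.[f e]) (Q \Po P).
Proof.
move=> fP; elim/poly_ind: Q => [|Q c IH].
  rewrite comp_poly0; apply: expands_near (expands_horner n 0).
  by near=> e; rewrite !horner0.
rewrite comp_polyD comp_polyM comp_polyX comp_polyC.
apply: expands_near; last first.
  exact: expandsD (expandsM IH fP) (expands_horner n c%:P).
by near=> e; rewrite /= hornerMXaddC hornerC.
Unshelve. all: by end_near. Qed.

Lemma horner_lipschitz0 {R : realType} (P : {poly R}) :
  exists2 C : R, 0 <= C & forall e : R, 0 <= e <= 1 -> `|P.[e] - P.[0]| <= C * e.
Proof.
elim/poly_ind: P => [|P c _].
  by exists 0 => // e _; rewrite !horner0 subrr normr0 mul0r.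
have [C C0 hC] := horner_bounded P; exists C => // e he.
rewrite !hornerMXaddC mulr0 add0r addrK normrM ler_pM ?hC//.
by case/andP: he => e0 _; rewrite ger0_norm.
Qed.

Lemma expands_trans {R : realType} n (f g : R -> R) P :
  (exists2 C : R, 0 <= C & \forall e \near 0^'+, `|f e - g e| <= C * e ^+ n) ->
  expands n g P -> expands n f P.
Proof.
move=> [C C0 hC] [D D0 hD]; exists (C + D); first exact: addr_ge0.
near=> e; rewrite -(subrK (g e) (f e)) -addrA (le_trans (ler_normD _ _))// mulrDl lerD//.
- by near: e.
- by near: e.
Unshelve. all: by end_near. Qed.

(** Substitution of the expansion of f into the binomial series of
    (P_0 (1 + u))^s, where u = f / P_0 - 1 = O(e). *)
Lemma expands_powR {R : realType} n (s : R) (f : R -> R) P :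
  expands n.+1 f P -> 0 < P`_0 ->
  expands n.+1 (fun e => f e `^ s)
    ((P`_0) `^ s *: (binpoly s n.+1 \Po ((P`_0)^-1 *: P - 1))).
Proof.
move=> fP P0; pose u e := (P`_0)^-1 * f e - 1.
have Hu : expands n.+1 u ((P`_0)^-1 *: P - 1).
  rewrite -[- 1]polyCN.
  apply: expands_near; last first.
    exact: expandsD (expandsZ _ fP) (expands_horner _ (-1)%:P).
  by near=> e; rewrite hornerC.
have [C C0 hC] := binomial_taylor n.+1 s.
have [D D0 hD] := fP.
have [L L0 hL] := horner_lipschitz0 P.
pose K := (P`_0)^-1 * (D + L).
have K0 : 0 <= K by rewrite mulr_ge0 ?addr_ge0 ?invr_ge0// ltW.
have iP0 : 0 <= (P`_0)^-1 by rewrite invr_ge0 ltW.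
have uK : \forall e \near 0^'+, `|u e| <= K * e.
  near=> e.
  have [e0 e1 _] : [/\ 0 < e, e <= 1 & e <= 1] by near: e; exact: near_right0_01.
  have -> : u e = (P`_0)^-1 * (f e - P`_0) by rewrite /u mulrBr mulVf ?gt_eqF.
  rewrite normrM (ger0_norm iP0) -mulrA ler_wpM2l//.
  rewrite -(subrK P.[e] (f e)) -addrA (le_trans (ler_normD _ _))// mulrDl lerD//.
    rewrite (@le_trans _ _ (D * e ^+ n.+1))//; first by near: e.
    by rewrite exprS mulrA ler_piMr ?exprn_ile1 ?mulr_ge0// ltW.
  by rewrite -horner_coef0 hL// !ltW.
have BC : expands n.+1 (fun e
  => (1 + u e) `^ s) (binpoly s n.+1 \Po ((P`_0)^-1 *: P - 1)).
  apply: expands_trans (expands_comp _ Hu).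
  exists (C * K ^+ n.+1); first by rewrite mulr_ge0 ?exprn_ge0.
  near=> e.
  have Ke : `|u e| <= K * e by near: e.
  have [e0 e1 e2] : [/\ 0 < e, e <= 1 & e <= (2 * (K + 1))^-1].
    by near: e; apply: near_right0_01; rewrite invr_gt0 mulr_gt0// ltr_wpDl.
  rewrite (le_trans (hC _ _))//.
    rewrite (le_trans Ke)// (@le_trans _ _ ((K + 1) * e))//.
      by rewrite ler_wpM2r ?lerDl// ltW.
    by rewrite -ler_pdivlMl ?ltr_wpDl// -invfM mulrC.
  rewrite -mulrA -exprMn ler_wpM2l// lerXn2r ?nnegrE//.
  by rewrite mulr_ge0// ltW.
apply: expands_near (expandsZ ((P`_0) `^ s) BC).
near=> e.
have Ke : `|u e| <= K * e by near: e.
have [e0 e1 e2] : [/\ 0 < e, e <= 1 & e <= (K + 1)^-1].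
  by near: e; apply: near_right0_01; rewrite invr_gt0 ltr_wpDl.
have u1 : 0 <= 1 + u e.
  have : `|u e| <= 1.
    rewrite (le_trans Ke)// (@le_trans _ _ ((K + 1) * e))//.
      by rewrite ler_wpM2r ?lerDl// ltW.
    by rewrite -ler_pdivlMl ?ltr_wpDl// mulr1.
  by rewrite ler_norml; lra.
rewrite -powRM// ?ltW//; congr (_ `^ _).
by rewrite /u addrC subrK mulrA divff ?gt_eqF// mul1r.
Unshelve. all: by end_near. Qed.

Lemma expands_le {R : realType} m n (f : R -> R) P :
  (m <= n)%N -> expands n f P -> expands m f P.
Proof.
move=> mn [C C0 hC]; exists C => //; near=> e.
have [e0 e1 _] : [/\ 0 < e, e <= 1 & e <= 1] by near: e; exact: near_right0_01.
rewrite (@le_trans _ _ (C * e ^+ n))//; first by near: e.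
by rewrite ler_wpM2l// ler_wiXn2l// ltW.
Unshelve. all: by end_near. Qed.

Lemma expands_take {R : realType} n (f : R -> R) P :
  expands n f P -> expands n f (take_poly n P).
Proof.
move=> [C C0 hC]; have [D D0 hD] := horner_bounded (drop_poly n P).
exists (C + D); first exact: addr_ge0.
near=> e.
have [e0 e1 _] : [/\ 0 < e, e <= 1 & e <= 1] by near: e; exact: near_right0_01.
have -> : f e - (take_poly n P).[e] = (f e - P.[e]) + (drop_poly n P).[e] * e ^+ n.
  by rewrite -{2}(poly_take_drop n P) hornerD hornerM hornerXn opprD addrA subrK.
rewrite (le_trans (ler_normD _ _))// mulrDl lerD//; first by near: e.
have en0 : 0 <= e ^+ n by rewrite exprn_ge0// ltW.
rewrite normrM (ger0_norm en0) ler_wpM2r//.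
by apply: hD; rewrite !ltW.
Unshelve. all: by end_near. Qed.

(** A polynomial that is O(e^n) at 0+ has no term of degree < n. *)
Lemma horner_littleo {R : realType} n (P : {poly R}) :
  expands n (fun=> 0) P -> forall k, (k < n)%N -> P`_k = 0.
Proof.
elim: n P => // n IH; elim/poly_ind => [_ k _|P c _ [C C0 hC]]; first by rewrite coef0.
have c0 : c = 0.
  have [D D0 hD] := horner_bounded P.
  apply/eqP/contraT => c0; suff: False by [].
  have d0 : 0 < `|c| / (2 * (C + D + 1)).
    by rewrite divr_gt0 ?normr_gt0// mulr_gt0// ltr_wpDl ?addr_ge0.
  have [e [he [e0 e1 e2]]] :=
    @filter_ex _ ((0:R)^'+) _ _ (filterI hC (near_right0_01 d0)).
  have Pe : `|P.[e] * e| <= D * e.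
    by rewrite normrM (ger0_norm (ltW e0)) ler_pM2r// hD// (ltW e0) e1.
  have Ce : C * e ^+ n.+1 <= C * e.
    by rewrite ler_wpM2l// exprS ler_piMr ?exprn_ile1// ltW.
  have ce : e * (2 * (C + D + 1)) <= `|c|.
    by rewrite -ler_pdivlMr// mulr_gt0// ltr_wpDl ?addr_ge0.
  have : `|c| <= C * e + D * e.
    move: he; rewrite hornerMXaddC sub0r normrN => he.
    have -> : c = (P.[e] * e + c) - P.[e] * e by ring.
    by rewrite (le_trans (ler_normB _ _))// lerD// (le_trans he).
  have : 0 < `|c| by rewrite normr_gt0.
  by nra.
subst c; rewrite addr0 in hC *.
move=> [|k]; first by rewrite coefMX.
rewrite ltnS coefMX /=; apply: IH; exists C => //; near=> e.
have [e0 e1 e2] : [/\ 0 < e, e <= 1 & e <= 1] by near: e; exact: near_right0_01.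
have : `|0 - (P * 'X).[e]| <= C * e ^+ n.+1 by near: e.
by rewrite hornerMX !sub0r !normrN normrM (ger0_norm (ltW e0)) exprSr mulrA ler_pM2r.
Unshelve. all: by end_near. Qed.

Lemma expands_uniq {R : realType} n (f : R -> R) P Q k :
  expands n f P -> expands n f Q -> (k < n)%N -> P`_k = Q`_k.
Proof.
move=> fP fQ kn; apply/eqP; rewrite -subr_eq0 -coefB; apply/eqP.
move: k kn; apply: horner_littleo.
have := expandsD fP (expandsZ (-1) fQ); rewrite scaleN1r.
apply: expands_near; near=> e; by rewrite mulN1r subrr.
Unshelve. all: by end_near. Qed.

(** Expansions to all orders have their coefficients in common: the coefficient
    of degree k can be read on any expansion of order > k. *)
Lemma expands_coefs {R : realType} (f : R -> R) :
  (forall n, exists P, expands n f P) ->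
  exists c : nat -> R, forall n, expands n f (\poly_(k < n) c k).
Proof.
move=> /choice[P hP]; exists (fun k => (P k.+1)`_k) => n.
suff -> : \poly_(k < n) (P k.+1)`_k = take_poly n (P n) by exact: expands_take.
apply/polyP => k; rewrite coef_poly coef_take_poly; case: ifP => // kn.
by apply: (@expands_uniq _ k.+1 f) => //; exact: expands_le (hP n).
Qed.

(** * Expansion of an expectation depending on a parameter *)

Section poly_mean.
Context {R : realType} {d : measure_display} {T : measurableType d}.
Variable Q : probability T R.

(** Integrability of a real-valued function. *)
Definition integrableR (f : T -> R) : Prop := Q.-integrable setT (EFin \o f).

Lemma integrableRD f g : integrableR f -> integrableR g ->
  integrableR (fun w => f w + g w).
Proof. by move=> fi gi; exact: (integrableD measurableT fi gi). Qed.

Lemma integrableRZ k f : integrableR f -> integrableR (fun w => k * f w).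
Proof. by move=> fi; exact: (integrableZl measurableT k fi). Qed.

(** g e is integrable and its integral is P.[e], for all e. *)
Definition poly_mean (g : R -> T -> R) (P : {poly R}) : Prop :=
  forall e, integrableR (g e) /\ \int[Q]_w g e w = P.[e].

Lemma poly_meanC (f : T -> R) :
  integrableR f -> poly_mean (fun=> f) (\int[Q]_w f w)%:P.
Proof. by move=> fi e; rewrite hornerC. Qed.

Lemma poly_meanD f g P S :
  poly_mean f P -> poly_mean g S -> poly_mean (fun e w => f e w + g e w) (P + S).
Proof.
move=> fP gS e; have [fi fe] := fP e; have [gi ge] := gS e; split.
  exact: integrableRD.
by rewrite RintegralD// fe ge hornerD.
Qed.

Lemma poly_meanZ (k : R) f P :
  poly_mean f P -> poly_mean (fun e w => k * f e w) (k *: P).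
Proof.
move=> fP e; have [fi fe] := fP e; split; first exact: integrableRZ.
by rewrite RintegralZl// fe hornerZ.
Qed.

Lemma poly_meanX f P :
  poly_mean f P -> poly_mean (fun e w => e * f e w) (P * 'X).
Proof.
move=> fP e; have [fi fe] := fP e; split; first exact: integrableRZ.
by rewrite RintegralZl// fe hornerMX mulrC.
Qed.

Variables h a b : T -> R.
Hypothesis hab : forall i j : nat,
  integrableR (fun w => h w * a w ^+ i * b w ^+ j).

(** The integral of h a^i b^j (a e + b e^2)^k as a polynomial in e. *)
Fixpoint moment_poly (k i j : nat) : {poly R} :=
  if k is k'.+1 then
    moment_poly k' i.+1 j * 'X + moment_poly k' i j.+1 * 'X * 'X
  else (\int[Q]_w (h w * a w ^+ i * b w ^+ j))%:P.

Lemma poly_mean_moment k i j :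
  poly_mean (fun e w => h w * a w ^+ i * b w ^+ j * (a w * e + b w * e ^+ 2) ^+ k)
    (moment_poly k i j).
Proof.
elim: k i j => [|k IH] i j /=.
  rewrite (_ : (fun e w => _) = (fun=> (fun w => h w * a w ^+ i * b w ^+ j))).
    exact: poly_meanC.
  by apply/funext => e; apply/funext => w; rewrite mulr1.
rewrite (_ : (fun e w => _) = (fun e w =>
  e * (h w * a w ^+ i.+1 * b w ^+ j * (a w * e + b w * e ^+ 2) ^+ k) +
  e * (e * (h w * a w ^+ i * b w ^+ j.+1 * (a w * e + b w * e ^+ 2) ^+ k)))).
  by apply: poly_meanD; do ?apply: poly_meanX; exact: IH.
by apply/funext => e; apply/funext => w; rewrite !exprS expr0; ring.
Qed.

Lemma moment_poly_ge2 k i j m : (m < k)%N -> (moment_poly k i j)`_m = 0.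
Proof.
elim: k i j m => // k IH i j m; rewrite ltnS /= => mk.
rewrite coefD !coefMX; case: m mk => [|m] mk /=; first by rewrite addr0.
rewrite IH// add0r; case: m mk => [|m] mk //=.
by rewrite IH// (ltn_trans _ mk).
Qed.

(** The integral of h B(a e + b e^2) as a polynomial in e, where B is the
    binomial polynomial binpoly s n. *)
Definition moment_expansion (s : R) (n : nat) : {poly R} :=
  \sum_(k < n) gbinom s k *: moment_poly k 0 0.

Lemma poly_mean_expansion s n :
  poly_mean (fun e w => h w * (binpoly s n).[a w * e + b w * e ^+ 2])
    (moment_expansion s n).
Proof.
rewrite /moment_expansion /binpoly; elim: n => [|n IH].
  rewrite big_ord0 (_ : (fun e w => _) = (fun=> (fun w
    => 0 * (h w * a w ^+ 0 * b w ^+ 0)))).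
    rewrite -(scale0r (\int[Q]_w (h w * a w ^+ 0 * b w ^+ 0))%:P).
    by apply: (poly_meanZ 0); exact: poly_meanC.
  by apply/funext => e; apply/funext => w; rewrite poly_def big_ord0 horner0; ring.
rewrite big_ord_recr /=.
rewrite (_ : (fun e w => _) = (fun e w =>
   h w * (\poly_(k < n) gbinom s k).[a w * e + b w * e ^+ 2] +
   gbinom s n * (h w * a w ^+ 0 * b w ^+ 0 * (a w * e + b w * e ^+ 2) ^+ n))).
  by apply: poly_meanD => //; apply: poly_meanZ; exact: poly_mean_moment.
apply/funext => e; apply/funext => w.
rewrite !poly_def big_ord_recr/= hornerD hornerZ hornerXn !expr0; ring.
Qed.

Lemma moment_expansion0 s n : (0 < n)%N ->
  (moment_expansion s n)`_0 = \int[Q]_w h w.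
Proof.
case: n => // n _; rewrite /moment_expansion big_ord_recl/= coefD scale1r coefC/=.
rewrite coef_sum big1 ?addr0; last first.
  by move=> k _; rewrite coefZ (moment_poly_ge2 0 0 (k := lift ord0 k)) ?mulr0.
by apply: eq_Rintegral => w _; rewrite !expr0 !mulr1.
Qed.

Lemma moment_expansion1 s n : (1 < n)%N ->
  (moment_expansion s n)`_1 = s * \int[Q]_w (h w * a w).
Proof.
case: n => // -[//|n] _; rewrite /moment_expansion 2!big_ord_recl/=
  !coefD scale1r coefC/=.
rewrite coef_sum big1 ?addr0; last first.
  by move=> k _; rewrite coefZ (moment_poly_ge2 0 0 (k :=
    lift ord0 (lift ord0 k))) ?mulr0.
rewrite coefZ coefD !coefMX/= coefC/= addr0 divr1 mulr1 add0r; congr (_ * _).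
by apply: eq_Rintegral => w _; rewrite expr1 !expr0 !mulr1.
Qed.

End poly_mean.

Section expectation_expansion.
Context {R : realType} {d : measure_display} {T : measurableType d}.
Variable Q : probability T R.
Variables h a b : T -> R.
Hypotheses (h0 : forall w, 0 <= h w)
  (mh : measurable_fun setT h) (ma : measurable_fun setT a) (mb : measurable_fun setT b).
Hypothesis hab : forall i j : nat,
  integrableR Q (fun w => h w * `|a w| ^+ i * `|b w| ^+ j).

Lemma integrableR_le (f g : T -> R) : measurable_fun setT f ->
  (forall w, `|f w| <= g w) -> integrableR Q g -> integrableR Q f.
Proof.
move=> mf fg; apply: le_integrable => //; first exact/measurable_EFinP.
by move=> w _; rewrite /= lee_fin (le_trans (fg w))// ler_norm.
Qed.

Lemma integrable_moment i j : integrableR Q (fun w => h w * a w ^+ i * b w ^+ j).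
Proof.
apply: integrableR_le (hab i j).
  by do ?apply: measurable_funM => //; apply: measurable_funX.
by move=> w; rewrite !normrM !normrX (ger0_norm (h0 w)).
Qed.

Let dom n w := h w * (`|a w| + `|b w|) ^+ n.

Lemma integrable_dom n : integrableR Q (dom n).
Proof.
have [+ _] := poly_mean_moment hab n 0 0 1.
rewrite (_ : (fun w => _) = dom n)//.
by apply/funext => w; rewrite /dom !expr0 !mulr1 expr1n !mulr1.
Qed.

Lemma norm_quadratic_le (x y e : R) n : 0 <= e <= 1 ->
  `|x * e + y * e ^+ 2| ^+ n <= e ^+ n * (`|x| + `|y|) ^+ n.
Proof.
move=> /andP[e0 e1]; rewrite -exprMn lerXn2r ?nnegrE//.
  by rewrite mulr_ge0// addr_ge0.
rewrite (le_trans (ler_normD _ _))// (normrM x) (normrM y) normrX mulrDr (ger0_norm e0).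
rewrite lerD//; first by rewrite mulrC.
by rewrite mulrC expr2 ler_wpM2r// ler_piMl.
Qed.

Lemma measurable_quadratic s e :
  measurable_fun setT (fun w => h w * `|1 + (a w * e + b w * e ^+ 2)| `^ s).
Proof.
apply: measurable_funM => //.
apply: (measurableT_comp (measurable_powR s)).
apply: measurableT_comp => //; apply: measurable_funD => //.
by apply: measurable_funD; apply: measurable_funM.
Qed.

(** The integral of h |1 + a e + b e^2|^s is approximated to any order by the
    integral of its formal binomial expansion. *)
Lemma expectation_taylor s n : 0 <= s ->
  exists2 C : R, 0 <= C & forall e, 0 <= e <= 1 ->
   integrableR Q (fun w => h w * `|1 + (a w * e + b w * e ^+ 2)| `^ s) /\
   `| \int[Q]_w (h w * `|1 + (a w * e + b w * e ^+ 2)| `^ s)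
      - (moment_expansion Q h a b s n).[e] | <= C * e ^+ n.
Proof.
move=> s0; have [C [m [C0 [nm hC]]]] := binomial_taylor_global n s0.
pose D := \int[Q]_w (dom n w + dom m w).
have dom0 k w : 0 <= dom k w by rewrite mulr_ge0// exprn_ge0// addr_ge0.
exists (C * D).
  by rewrite mulr_ge0// Rintegral_ge0// => w _; rewrite addr_ge0.
move=> e e01; have [e0 e1] := andP e01.
pose u w := a w * e + b w * e ^+ 2.
have key w : `| h w * `|1 + u w| `^ s - h w * (binpoly s n).[u w] | <=
   (C * e ^+ n) * (dom n w + dom m w).
  rewrite -mulrBr normrM (ger0_norm (h0 w)).
  rewrite (le_trans (ler_wpM2l (h0 w) (hC (u w))))//.
  rewrite mulrCA -!mulrA ler_wpM2l// /dom -mulrDr mulrCA ler_wpM2l// mulrDr lerD//.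
    exact: norm_quadratic_le.
  rewrite (le_trans (norm_quadratic_le _ _ _ _))// ler_wpM2r ?exprn_ge0 ?addr_ge0//.
  by rewrite ler_wiXn2l.
have [i1 E1] := poly_mean_expansion integrable_moment s n e.
have idom : integrableR Q (fun w => (C * e ^+ n) * (dom n w + dom m w)).
  by apply: integrableRZ; apply: integrableRD => //; exact: integrable_dom.
have mF := measurable_quadratic s e.
have i3 : integrableR Q (fun w => h w * `|1 + u w| `^ s - h w * (binpoly s n).[u w]).
  apply: integrableR_le idom => //.
  by apply: measurable_funB => //; apply/measurable_EFinP; exact: (measurable_int _ i1).
have i2 : integrableR Q (fun w => h w * `|1 + u w| `^ s).
  rewrite (_ : (fun w => _) = (fun w
    => (h w * `|1 + u w| `^ s - h w * (binpoly s n).[u w]) + h w * (binpoly s n).[u w])).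
    exact: integrableRD.
  by apply/funext => w; rewrite subrK.
split=> //; rewrite -E1 -RintegralB//.
rewrite (le_trans (le_normr_Rintegral _ _))//.
rewrite mulrAC -RintegralZl//; last by apply: integrableRD => //; exact: integrable_dom.
apply: le_Rintegral => //.
  exact: integrable_norm.
Qed.

Lemma expands_expectation s n : 0 <= s ->
  expands n (fun e => \int[Q]_w (h w * `|1 + (a w * e + b w * e ^+ 2)| `^ s))
    (moment_expansion Q h a b s n).
Proof.
move=> s0; have [C C0 hC] := expectation_taylor n s0; exists C => //.
near=> e; have [] := hC e; last by [].
have [e0 -> _] : [/\ 0 < e, e <= 1 & e <= 1] by near: e; exact: near_right0_01.
by rewrite ltW.
Unshelve. all: by end_near. Qed.

End expectation_expansion.

(** * Measurability of first exit times of continuous paths *)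

Lemma measurable_norm_gt {R : realType} {d} {T : measurableType d} (f : T -> R) (a : R) :
  measurable_fun setT f -> measurable [set w | a < `|f w|].
Proof.
move=> mf; have mn : measurable_fun setT (fun w => `|f w|) by exact: measurableT_comp.
rewrite (_ : mkset _ = (fun w => `|f w|) @^-1` `]a, +oo[%classic).
  by rewrite -[X in measurable X]setTI; apply: mn => //; exact: measurable_itv.
by apply/seteqP; split => w /=; rewrite in_itv/= andbT.
Qed.

Lemma measurable_ge {R : realType} {d} {T : measurableType d} (Y : T -> R) (x : R) :
  measurable_fun setT Y -> measurable [set w | x <= Y w].
Proof.
move=> mY; rewrite (_ : mkset _ = Y @^-1` `[x, +oo[%classic).
  by rewrite -[X in measurable X]setTI; apply: mY => //; exact: measurable_itv.
by apply/seteqP; split => w /=; rewrite in_itv/= andbT.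
Qed.

Lemma measurable_funV_ge0 {R : realType} {d} {T : measurableType d} (f : T -> R) :
  (forall w, 0 <= f w) -> measurable_fun setT f ->
  measurable_fun setT (fun w => (f w)^-1).
Proof.
move=> f0 mf; rewrite (_ : (fun w => _) = (fun w => f w `^ (-1))).
  exact: (measurableT_comp (measurable_powR (-1)) mf).
by apply/funext => w; rewrite powR_inv1.
Qed.

Lemma maxr0_continuous {R : realType} : continuous (fun t : R => Num.max 0 t).
Proof.
apply: (@max_fun_continuous _ R R (cst 0) id); first exact: cst_continuous.
by move=> x; exact: cvg_id.
Qed.

(** A path that is continuous on [0, +oo[ is made continuous on the line by
    giving it the constant value f 0 on negative times. *)
Lemma continuous_stopped_at0 {R : realType} (f : R -> R) :
  {within `[0, +oo[, continuous f} -> continuous (fun t : R => f (Num.max 0 t)).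
Proof.
move=> /subspace_continuousP cf t.
have m0 : `[0, +oo[%classic (Num.max 0 t) by rewrite /= in_itv/= andbT le_max lexx.
move=> W /(cf _ m0) hW.
have h : nbhs t (fun x : R => `[0, +oo[%classic (Num.max 0 x) -> W (f (Num.max 0 x))).
  exact: (@maxr0_continuous R t _ hW).
apply: (filterS _ h) => x /=; apply.
by rewrite in_itv/= andbT le_max lexx.
Qed.

Lemma exists_natSinv_lt {R : realType} (e : R) : 0 < e ->
  exists n : nat, n.+1%:R^-1 < e.
Proof.
by move=> e0; have [n _ hn] := near_infty_natSinv_lt (PosNum e0); exists n;
  exact: hn (leqnn n).
Qed.

(** An open set of the plane is a countable union of rational boxes. *)
Lemma open_preimage_measurable {R : realType} {d} {T : measurableType d}
    (f g : T -> R) (O : set (R * R)) :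
  measurable_fun setT f -> measurable_fun setT g -> open O ->
  measurable [set w | O (f w, g w)].
Proof.
move=> mf mg oO.
pose box (q : rat * rat * nat) : set (R * R) :=
  ball ((ratr q.1.1, ratr q.1.2) : R * R) (q.2.+1%:R^-1).
pose F (q : rat * rat * nat) : set T :=
  [set w | box q `<=` O /\ box q (f w, g w)].
have -> : [set w | O (f w, g w)] = \bigcup_q F q.
  apply/seteqP; split=> [w /= Ow|w [q _ [/= sO /sO//]]].
  have /nbhs_ballP[e /= e0 he] : nbhs (f w, g w) O by exact: open_nbhs_nbhs.
  have [n hn] := exists_natSinv_lt (divr_gt0 e0 (ltr0Sn R 1)).
  have n0 : 0 < n.+1%:R^-1 :> R by rewrite invr_gt0.
  have [q1 hq1] := @rat_in_itvoo R (f w) (f w + n.+1%:R^-1) (ltr_pwDr n0 (lexx _)).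
  have [q2 hq2] := @rat_in_itvoo R (g w) (g w + n.+1%:R^-1) (ltr_pwDr n0 (lexx _)).
  have bq : box (q1, q2, n) (f w, g w).
    move: hq1 hq2; rewrite !in_itv/= => /andP[a1 b1] /andP[a2 b2].
    by split; rewrite /ball/= ger0_norm ?subr_ge0 ?ltrBlDl// ltW.
  exists (q1, q2, n) => //; split => //= z bz; apply: he.
  have H1 := le_ball (ltW hn) (ball_sym bq).
  have H2 := le_ball (ltW hn) bz.
  by rewrite (splitr e); exact: ball_triangle H1 H2.
apply: countable_bigcupT_measurable => // q.
have [sO|nO] := pselect (box q `<=` O); last first.
  rewrite (_ : F q = set0)//; apply/seteqP; split=> // w [] //.
have -> : F q = f @^-1` (ball (ratr q.1.1 : R) q.2.+1%:R^-1) `&` g @^-1` (ball (ratr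
  q.1.2 : R) q.2.+1%:R^-1).
  by apply/seteqP; split=> w /= => [[_ []]//|[]].
by apply: measurableI; rewrite -[X in measurable X]setTI; [apply: mf|apply: mg] => //;
  apply: open_measurable; exact: ball_open.
Qed.

Section first_exit_time.
Context {R : realType} {d : measure_display} {T : measurableType d}.
Variables (X Y : R -> T -> R) (V : set (R * R)).
Hypotheses (mX : forall t, measurable_fun setT (X t))
  (mY : forall t, measurable_fun setT (Y t))
  (cX : forall w, continuous (X ^~ w)) (cY : forall w, continuous (Y ^~ w))
  (oV : open V).

Let Z t w := (X t w, Y t w).

(** The points whose ball of radius r is not contained in V form an open set,
    even when V is arbitrary. *)
Lemma open_not_ball_sub (r : R) : open (~` [set z : R * R | ball z r `<=` V]).
Proof.
rewrite (_ : ~` _ = \bigcup_(y in ~` V) ball y r).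
  by apply: bigcup_open => y _; exact: ball_open.
apply/seteqP; split=> [z /= /existsNP[y /not_implyP[zy nVy]]|z /= [y nVy yz] zV].
  by exists y => //; exact: ball_sym.
by apply: nVy; apply: zV; exact: ball_sym.
Qed.

Lemma cvg_path w (t : R) : Z u w @[u --> t] --> Z t w.
Proof. exact: (cvg_pair (@cX w t) (@cY w t)). Qed.

(** The projection on [0, s], by which a rational number gives a time of [0, s]. *)
Let clamp (s q : R) := Num.min s (Num.max 0 q).

Lemma clamp_continuous s : continuous (clamp s).
Proof.
apply: (@min_fun_continuous _ R R (cst s) (fun q : R => Num.max 0 q)).
  exact: cst_continuous.
exact: maxr0_continuous.
Qed.

(** The path stays in V during [0, s]. *)
Definition stays_in (s : R) : set T := [set w | forall u, 0 <= u <= s -> V (Z u w)].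

(** By compactness of [0, s], a path that stays in the open set V also stays in
    the set of points whose ball of radius 1 / (n + 1) is contained in V, for
    some n; the latter is a closed condition, to be tested on a dense set. *)
Lemma stays_inE (s : R) : 0 <= s -> stays_in s =
  \bigcup_n ~` (\bigcup_(q : rat)
    [set w | (~` [set z | ball z (n.+1%:R^-1) `<=` V])
               (Z (clamp s (ratr q)) w)]).
Proof.
move=> s0; apply/seteqP; split => [w hw|w [n _ /= hn] u us].
- have cs : compact `[0, s] by exact: segment_compact.
  have /compact_near_coveringP := cs.
  move=> /(_ nat \oo (fun n u => ball (Z u w) (n.+1%:R^-1) `<=` V)).
  case.
    move=> u; rewrite /= in_itv/= => us.
    have /nbhs_ballP[e /= e0 he] : nbhs (Z u w) V.
      by apply: open_nbhs_nbhs; split => //; exact: hw.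
    have e20 : 0 < e / 2 by rewrite divr_gt0.
    have hU : \forall u' \near u, ball (Z u w) (e / 2) (Z u' w).
      by apply: (cvg_path (w := w) (t := u)); exact: nbhsx_ballx.
    have hN : \forall n \near \oo, n.+1%:R^-1 < e / 2
      by exact: (near_infty_natSinv_lt (PosNum e20)).
    exists ([set u' | ball (Z u w) (e / 2) (Z u' w)],
      [set n : nat | n.+1%:R^-1 < e / 2]) => //.
    move=> [u' n] [/= H1 hn] z zu; apply: he; rewrite (splitr e).
    have H2 : ball (Z u' w) (e / 2) z by apply: le_ball zu; exact: ltW.
    exact: ball_triangle H1 H2.
  move=> n _ hn; exists n => //= -[q _ /=]; apply.
  apply: (hn n (leqnn n)) => /=; rewrite in_itv/= /clamp le_min s0 ge_min lexx.
  by rewrite le_max lexx.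
- have /nbhs_ballP[r /= r0 hr] : \forall q \near u,
  ball (Z u w) (n.+1%:R^-1) (Z (clamp s q) w).
    have cu : clamp s u = u.
      by case/andP: us => u0 us; rewrite /clamp max_r// min_r.
    have := @clamp_continuous s u; rewrite /continuous_at cu => hc.
    have /= := cvg_comp _ _ hc (cvg_path (w := w) (t := u)).
    by apply; apply: nbhsx_ballx; rewrite invr_gt0.
  have [q hq] := @rat_in_itvoo R u (u + r) (ltr_pwDr r0 (lexx _)).
  have {}hq : ball u r (ratr q : R).
    move: hq; rewrite in_itv/= => /andP[a1 b1].
    by rewrite /ball/= distrC ger0_norm ?subr_ge0 ?ltrBlDl// ltW.
  have hb := hr _ hq.
  apply: contrapT => nV; apply: hn; exists q => //= hV.
  by apply/nV/hV; exact: ball_sym.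
Qed.

Lemma measurable_stays_in (s : R) : measurable (stays_in s).
Proof.
have [s0|s0] := leP 0 s; last first.
  rewrite (_ : stays_in s = setT)//; apply/seteqP; split=> // w _ u /andP[u0 us].
  by move: (le_lt_trans (le_trans u0 us) s0); rewrite ltxx.
rewrite stays_inE//; apply: bigcupT_measurable => n; apply: measurableC.
apply: bigcupT_measurable_rat => q.
apply: open_preimage_measurable => //; exact: open_not_ball_sub.
Qed.

(** The first exit time of the path (X, Y) from V, +oo if there is none. *)
Definition first_exit (w : T) : \bar R :=
  ereal_inf [set t%:E | t in [set t : R | 0 <= t /\ ~ V (Z t w)]].

Lemma first_exit_ge (s : R) w : (s%:E <= first_exit w)%E <->
  (forall u, 0 <= u -> u < s -> V (Z u w)).
Proof.
split=> [sw u u0 us|h].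
  apply: contrapT => nV; move: sw; rewrite leNgt => /negP; apply.
  by apply: (@le_lt_trans _ _ u%:E); rewrite ?lte_fin//; apply: ereal_inf_lbound;
    exists u.
apply: le_ereal_inf_tmp => _ [t [t0 nV] <-]; rewrite lee_fin leNgt; apply/negP => ts.
by apply: nV; exact: h.
Qed.

Lemma measurable_first_exit : measurable_fun setT first_exit.
Proof.
move=> mD; apply: (measurability _ (ErealGenCInfty.measurableE R)) => //.
move=> _ [_ [r ->] <-]; rewrite setTI.
rewrite (_ : _ @^-1` _ = \bigcap_n (stays_in (r - n.+1%:R^-1))); last first.
  apply/seteqP; split => w /=; rewrite in_itv/= andbT first_exit_ge.
    move=> h n _ u /andP[u0 ur]; apply: h => //.
    by rewrite (le_lt_trans ur)// gtrDl oppr_lt0 invr_gt0.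
  move=> h u u0 ur; have := exists_natSinv_lt (_ : 0 < r - u).
  rewrite subr_gt0 => /(_ ur)[n hn]; apply: (h n I).
  by rewrite u0/= lerBrDr -lerBrDl ltW.
by apply: bigcapT_measurable => n; exact: measurable_stays_in.
Qed.

Lemma first_exit_ge0 w : (0 <= first_exit w)%E.
Proof. by apply/first_exit_ge => u u0 /(le_lt_trans u0); rewrite ltxx. Qed.

(** V is open, so that the path is out of V at the first exit time. *)
Lemma first_exit_notin w : (first_exit w < +oo)%E ->
  ~ V (Z (fine (first_exit w)) w).
Proof.
move=> toy; have t0 := first_exit_ge0 w.
have tE : ((fine (first_exit w))%:E = first_exit w)%E by rewrite fineK// ge0_fin_numE.
set t := fine _ in tE *; move=> Vt.
have /nbhs_ballP[r /= r0 hr] : \forall u \near t, V (Z u w).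
  by apply: (cvg_path (w := w) (t := t)); apply: open_nbhs_nbhs.
suff : ((t + r)%:E <= first_exit w)%E by rewrite -tE lee_fin gerDl leNgt r0.
apply/first_exit_ge => u u0 utr; have [ut|tu] := ltP u t.
  by have := lexx (first_exit w); rewrite -{1}tE => /first_exit_ge; exact.
by apply: hr; rewrite /ball/= distrC ger0_norm ?subr_ge0// ltrBlDl.
Qed.

(** Up to the first exit time the path is in V, so that its position at that time
    is in the closure of V. *)
Lemma first_exit_adherent w (W : set (R * R)) : open W ->
  0 < fine (first_exit w) -> W (Z (fine (first_exit w)) w) ->
  exists u, V (Z u w) /\ W (Z u w).
Proof.
move=> oW; have t0 := first_exit_ge0 w.
set t := fine _ => t_gt0 Wt.
have tE : (t%:E = first_exit w)%E.
  rewrite fineK// ge0_fin_numE// ltey; apply/eqP => ty.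
  by move: t_gt0; rewrite /t ty ltxx.
have /nbhs_ballP[r /= r0 hr] : \forall u \near t, W (Z u w).
  by apply: (cvg_path (w := w) (t := t)); apply: open_nbhs_nbhs.
pose u := Num.max 0 (t - r / 2).
have ut : u < t by rewrite /u gt_max t_gt0/= gtrDl oppr_lt0 divr_gt0.
exists u; split.
  have := lexx (first_exit w); rewrite -{1}tE => /first_exit_ge; apply => //.
  by rewrite /u le_max lexx.
apply: hr; rewrite /ball/= ger0_norm ?subr_ge0 1?ltW//.
have : t - r / 2 <= u by rewrite /u le_max lexx orbT.
by lra.
Qed.

End first_exit_time.

(** A continuous process evaluated at a random time f is the limit of its values
    at the times floor (n f) / n, which take countably many values. *)
Lemma measurable_fun_random_time {R : realType} {d} {T : measurableType d}
    (X : R -> T -> R) (f : T -> R) :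
  (forall t, measurable_fun setT (X t)) -> (forall w, continuous (X ^~ w)) ->
  measurable_fun setT f -> measurable_fun setT (fun w => X (f w) w).
Proof.
move=> mX cX mf.
pose g (n : nat) (w : T) : R := (Num.floor (f w * n.+1%:R))%:~R / n.+1%:R.
apply: (@measurable_fun_cvg _ _ _ _ (fun n w => X (g n w) w)).
- move=> n _ A mA; rewrite setTI.
  rewrite (_ : _ @^-1` _ = \bigcup_(k : int)
     ([set w | k%:~R <= f w * n.+1%:R < (k + 1)%:~R] `&` X (k%:~R / n.+1%:R) @^-1` A)).
    apply: countable_bigcupT_measurable => // k; apply: measurableI.
      have mfn : measurable_fun setT (fun w => f w * n.+1%:R) by apply: measurable_funM.
      rewrite (_ : mkset _ = (fun w => f w * n.+1%:R) @^-1` `[k%:~R,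
        (k + 1)%:~R[%classic).
        by rewrite -[X in measurable X]setTI; apply: mfn => //; exact: measurable_itv.
      by apply/seteqP; split => w /=; rewrite in_itv/=.
    by rewrite -[X in measurable X]setTI; exact: mX.
  apply/seteqP; split => [w /= hw|w [k _ /= [kf Ak]]].
    exists (Num.floor (f w * n.+1%:R)) => //=; split => //.
    by rewrite floor_itv.
  by rewrite /g (floor_def kf).
- move=> w _; have /= :=
  @cvg_comp _ _ _ (g ^~ w) (X ^~ w) \oo (nbhs (f w)) (nbhs (X (f w) w)) _ (cX w (f w)).
  apply; apply/cvgrPdist_lt => e e0.
  have [n _ hn] := near_infty_natSinv_lt (PosNum e0).
  exists n => // m /hn /= me; rewrite (le_lt_trans _ me)//.
  have m0 : 0 < m.+1%:R :> R by [].
  rewrite /g -[X in `|X - _|](mulfK (lt0r_neq0 m0)) -mulrBl normrM.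
  rewrite [X in _ * X]ger0_norm ?invr_ge0// -[leRHS]mul1r ler_wpM2r ?invr_ge0//.
  have /andP[h1 h2] := floor_itv (f w * m.+1%:R).
  rewrite ger0_norm ?subr_ge0// lerBlDl ltW//.
  by move: h2; rewrite intrD.
Qed.

(** * Gaussian tails *)

Lemma nneseries_geometric_le {R : realType} (a z : R) : 0 <= a -> 0 < z < 1 ->
  (\sum_(n <oo) (a * z ^+ n)%:E <= (a / (1 - z))%:E)%E.
Proof.
move=> a0 /andP[z0 z1]; have u0 (n : nat) : (0 <= (a * z ^+ n)%:E)%E.
  by rewrite lee_fin mulr_ge0// exprn_ge0// ltW.
apply: (lime_le (is_cvg_nneseries (fun n _ _ => u0 n))).
apply: nearW => n; rewrite sumEFin lee_fin.
have := @geometric_le_lim R n a z a0 z0.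
by rewrite gtr0_norm//; exact.
Qed.

Lemma expRN_le_inv_exp {R : realType} (m : nat) (y : R) : (0 < m)%N -> 0 < y ->
  expR (- y) <= (m%:R / y) ^+ m.
Proof.
move=> m0 y0; have m0' : 0 < m%:R :> R by rewrite ltr0n.
have h : (y / m%:R) ^+ m <= expR y.
  rewrite -[y in leRHS](divfK (lt0r_neq0 m0')) expRM_natr.
  rewrite lerXn2r ?nnegrE ?expR_ge0//; first by rewrite divr_ge0// ltW.
  by rewrite (le_trans _ (expR_ge1Dx _))// lerDr.
rewrite expRN -[leRHS]invrK lef_pV2 ?posrE ?expR_gt0//.
  by rewrite -exprVn invf_div.
by rewrite invr_gt0 exprn_gt0// divr_gt0.
Qed.

(** On |x| > a the Gaussian density is at most exp (- a^2 / (4 s^2)) times a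
    multiple of the density with standard deviation sqrt 2 * s. *)
Lemma normal_prob_tail {R : realType} (s a : R) : 0 < s -> 0 < a ->
  (normal_prob 0 s [set x | (a < `|x|)%R] <=
     (Num.sqrt 2 * expR (- (a ^+ 2 / (4 * s ^+ 2))))%:E)%E.
Proof.
move=> s0 a0; set r2 := Num.sqrt 2.
have r20 : 0 < r2 by rewrite sqrtr_gt0.
have rs0 : 0 < r2 * s by rewrite mulr_gt0.
have r22 : r2 ^+ 2 = 2 by rewrite sqr_sqrtr.
set K := r2 * expR _.
have K0 : 0 <= K by rewrite mulr_ge0 ?expR_ge0// ltW.
have mA : measurable [set x : R | a < `|x|] by exact: (measurable_norm_gt (f := id)).
rewrite /normal_prob.
apply: (@le_trans _ _ (\int[lebesgue_measure]_(x in [set x : R | (a < `|x|)%R])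
    (K%:E * (normal_pdf 0 (r2 * s) x)%:E))%E).
  apply: ge0_le_integral => //.
  - by move=> x _; rewrite lee_fin normal_pdf_ge0.
  - by apply/measurable_funTS/measurable_EFinP; exact: measurable_normal_pdf.
  - by apply/measurable_funTS/measurable_EFinP/measurable_funM => //;
    exact: measurable_normal_pdf.
  - move=> x /= ax; rewrite -EFinM lee_fin !normal_pdfE ?gt_eqF//.
    rewrite /normal_peak /normal_fun !subr0.
    have -> : (r2 * s) ^+ 2 * pi *+ 2 = 2 * (s ^+ 2 * pi *+ 2) by rewrite exprMn r22;
      ring.
    rewrite sqrtrM// invfM -/r2.
    set k := (Num.sqrt _)^-1.
    have k0 : 0 <= k by rewrite invr_ge0 sqrtr_ge0.
    rewrite /K.
    have -> : r2 * expR (- (a ^+ 2 / (4 * s ^+ 2))) *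
       (r2^-1 * k * expR (- x ^+ 2 / ((r2 * s) ^+ 2 *+ 2))) =
       k * (expR (- (a ^+ 2 / (4 * s ^+ 2))) * expR (- x ^+ 2 / ((r2 * s) ^+ 2 *+ 2))).
      by field; rewrite gt_eqF.
    rewrite ler_wpM2l// -expRD ler_expR exprMn r22.
    have -> : - x ^+ 2 / (s ^+ 2 *+ 2) =
      - (x ^+ 2 / (4 * s ^+ 2)) + - x ^+ 2 / (2 * s ^+ 2 *+ 2).
      by field; rewrite gt_eqF.
    rewrite lerD2r lerN2 ler_wpM2r//.
      by rewrite invr_ge0 mulr_ge0 ?sqr_ge0.
    by rewrite -(real_normK (num_real x)) lerXn2r ?nnegrE// ltW.
rewrite ge0_integralZl_EFin//; last 2 first.
  - by move=> x _; rewrite lee_fin normal_pdf_ge0.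
  - by apply/measurable_funTS/measurable_EFinP; exact: measurable_normal_pdf.
rewrite -[leRHS]mule1 lee_wpmul2l//.
exact: (@probability_le1 _ _ _ (normal_prob 0 (r2 * s)) _ mA).
Qed.

Lemma normal_prob_bounded_lt1 {R : realType} (a : R) : 0 <= a ->
  (normal_prob (0:R) 1 [set x | (`|x| <= a)%R] < 1)%E.
Proof.
move=> a0.
pose B := `[a + 1, a + 2]%classic : set R.
have mA : measurable [set x : R | `|x| <= a].
  rewrite (_ : mkset _ = (fun x : R => `|x|) @^-1` `]-oo, a]%classic).
    by rewrite -[X in measurable X]setTI; apply: normr_measurable => //;
      exact: measurable_itv.
  by apply/seteqP; split => x /=; rewrite in_itv/=.
have mB : measurable B by exact: measurable_itv.
set N := normal_prob 0 1.
have B_gt0 : (0 < N B)%E.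
  pose c : R := normal_peak 1 * expR (- (a + 2) ^+ 2 / (1 ^+ 2 *+ 2)).
  have c0 : 0 < c by rewrite mulr_gt0 ?expR_gt0// normal_peak_gt0 ?oner_eq0.
  apply: (@lt_le_trans _ _ (\int[lebesgue_measure]_(x in B) (c%:E))%E).
    rewrite /B integral_cst//= lebesgue_measure_itv/= lte_fin ltrD2l ltr1n.
    by rewrite -EFinB -EFinM lte_fin mulr_gt0//; lra.
  apply: ge0_le_integral => //.
  - by move=> x _; rewrite lee_fin ltW.
  - by apply/measurable_funTS/measurable_EFinP; exact: measurable_normal_pdf.
  - move=> x; rewrite /B/= in_itv/= => /andP[x1 x2];
    rewrite lee_fin normal_pdfE ?oner_eq0//.
    rewrite ler_wpM2l ?normal_peak_ge0// ler_expR subr0.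
    rewrite ler_wpM2r ?invr_ge0// lerN2 lerXn2r ?nnegrE//; lra.
have AB : (N [set x : R | (`|x| <= a)%R] + N B <= 1)%E.
  rewrite -measureU//.
    exact: (@probability_le1 _ _ _ (normal_prob (0:R) 1) _ (measurableU _ _ mA mB)).
  apply/seteqP; split => // x /= []; rewrite /B/= in_itv/= => xa /andP[ax _].
  by have := ler_norm x; lra.
rewrite ltNge; apply/negP => A1.
move: AB; apply/negP; rewrite -ltNge.
apply: (lt_le_trans _ (leeD2r (N B) A1)).
by rewrite lteDl.
Qed.

(** * Tail estimates for Brownian motion *)

(** The k-th dyadic point of level n of the interval [0, s]. *)
Definition dyadic {R : realType} (s : R) (n k : nat) : R := k%:R * (s / 2 ^+ n).

Lemma dyadic_doubleE {R : realType} (s : R) n k : dyadic s n.+1 k.*2 = dyadic s n k.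
Proof.
rewrite /dyadic -muln2 natrM exprS invfM.
by field; rewrite expf_neq0.
Qed.

(** The right-hand side is the sum of c (3/4)^i for i <= n. *)
Lemma dyadic_bound {R : realType} (x : R -> R) (s c : R) : x 0 = 0 -> 0 <= c ->
  (forall n k, (k < 2 ^ n)%N ->
     `|x (dyadic s n k.+1) - x (dyadic s n k)| <= c * (3 / 4) ^+ n) ->
  forall n k, (k <= 2 ^ n)%N ->
     `|x (dyadic s n k)| <= 4 * c * (1 - (3 / 4) ^+ n.+1).
Proof.
move=> x0 c0 inc; elim=> [|n IH] k.
  rewrite expn0 leq_eqVlt ltnS leqn0 => /orP[] /eqP ->.
    have := inc 0%N 0%N isT; rewrite /dyadic mul0r x0 subr0 => h.
    by rewrite (le_trans h)// expr0 expr1; lra.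
  by rewrite /dyadic mul0r x0 normr0 expr1; lra.
have r0 : 0 <= (3 / 4 : R) ^+ n.+1 by rewrite exprn_ge0.
rewrite expnS mul2n => kn.
have stepE : 4 * c * (1 - (3 / 4) ^+ n.+2) =
  4 * c * (1 - (3 / 4) ^+ n.+1) + c * (3 / 4) ^+ n.+1.
  by rewrite [_ ^+ n.+2]exprS; field.
have [ko|ke] := boolP (odd k); last first.
  rewrite -[k]odd_double_half (negbTE ke) add0n dyadic_doubleE.
  rewrite stepE (le_trans (IH _ _)) ?lerDl ?mulr_ge0//.
  by rewrite -leq_double (leq_trans _ kn)// -{2}[k]odd_double_half leq_addl.
rewrite -[k]odd_double_half ko add1n in kn *.
rewrite -(subrK (x (dyadic s n.+1 k./2.*2)) (x _)) (le_trans (ler_normD _ _))//.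
rewrite stepE addrC lerD//.
  by rewrite dyadic_doubleE IH// -leq_double ltnW.
by apply: inc; rewrite expnS mul2n.
Qed.

(** If the dyadic increments of level n are at most c (3/4)^n, for all n, then the
    path is bounded by the sum 4 c of this series. *)
Lemma dyadic_chaining {R : realType} (x : R -> R) (s c : R) :
  continuous x -> x 0 = 0 -> 0 <= c -> 0 < s ->
  (forall n k, (k < 2 ^ n)%N ->
     `|x (dyadic s n k.+1) - x (dyadic s n k)| <= c * (3 / 4) ^+ n) ->
  forall u, 0 <= u <= s -> `|x u| <= 4 * c.
Proof.
move=> cx x0 c0 s0 inc u /andP[u0 us].
rewrite leNgt; apply/negP => xu.
have e0 : 0 < `|x u| - 4 * c by rewrite subr_gt0.
have /nbhs_ballP[r /= r0 hr] : \forall v \near u, ball (x u) (`|x u| - 4 * c) (x v).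
  by apply: cx; exact: nbhsx_ballx.
have rs0 : 0 < r / s by rewrite divr_gt0.
have [n _ /(_ n (leqnn n))/= hn] := near_infty_natSinv_expn_lt (PosNum rs0).
pose k := Num.truncn (u / (s / 2 ^+ n)).
have sn0 : 0 < s / 2 ^+ n by rewrite divr_gt0// exprn_gt0.
have un0 : 0 <= u / (s / 2 ^+ n) by rewrite divr_ge0// ltW.
have /andP[k1 k2] := truncn_itv un0.
have ku : dyadic s n k <= u by rewrite /dyadic -ler_pdivlMr.
have uk : u < dyadic s n k + s / 2 ^+ n.
  move: k2; rewrite ltr_pdivrMr// -natr1 mulrDl mul1r; exact.
have snr : s / 2 ^+ n < r.
  by move: hn; rewrite div1r ltr_pdivlMr// mulrC.
have hb : ball u r (dyadic s n k).
  by rewrite /ball/= ger0_norm ?subr_ge0// (lt_trans _ snr)// ltrBlDl.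
have := hr _ hb; rewrite /ball/= => h1.
have kn : (k <= 2 ^ n)%N.
  by rewrite -(ler_nat R) (le_trans k1)// natrX ler_pdivrMr// mulrCA divff ?mulr1//.
have := dyadic_bound x0 c0 inc kn.
have h3 : 0 <= 4 * c * (3 / 4) ^+ n.+1 by rewrite !mulr_ge0.
have := lerB_dist (x u) (x (dyadic s n k)).
rewrite mulrBr mulr1.
by lra.
Qed.

Section brownian_tails.
Context {R : realType} {d : measure_display} {T : measurableType d}.
Variables (P : probability T R) (B : R -> {RV P >-> R}).
Hypothesis hB : standard_BM B.

(** By the union bound over the dyadic increments of all levels, the probability
    that |B| exceeds 4 c during [0, s] is O(s^m). A is a measurable
    event that contains this one. *)
Lemma brownian_sup_tail (c : R) (m : nat) : 0 < c -> (6 <= m)%N ->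
  exists2 K : R, 0 <= K & forall s, 0 < s -> exists A : set T,
    [/\ measurable A, (P A <= (K * s ^+ m)%:E)%E &
      forall w, ~ A w -> continuous (fun t : R => B (Num.max 0 t) w) ->
        forall u, 0 <= u <= s -> `|B u w| <= 4 * c].
Proof.
move=> c0 m6; have [B0 _ Binc _] := hB.
have m0 : (0 < m)%N by rewrite (leq_trans _ m6).
(* Each of the 2^n increments of level n contributes a multiple of (8/9)^(n m);
   6 <= m makes the sum over n geometric with a ratio at most z < 1. *)
pose z : R := 2 * (8 / 9) ^+ 6.
have z01 : 0 < z < 1 by rewrite /z; apply/andP; split; lra.
pose K0 : R := Num.sqrt 2 * (4 * m%:R / c ^+ 2) ^+ m.
have K00 : 0 <= K0.
  by apply: mulr_ge0; rewrite ?sqrtr_ge0//; apply: exprn_ge0; apply: divr_ge0;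
    [exact: mulr_ge0 | exact: exprn_ge0 (ltW c0)].
exists (K0 / (1 - z)).
  by rewrite divr_ge0// subr_ge0; case/andP: z01 => _ /ltW.
move=> s s0.
pose D n k w := B (dyadic s n k.+1) w - B (dyadic s n k) w.
have mD n k : measurable_fun setT (D n k) by apply: measurable_funB.
pose A1 n k := [set w | c * (3 / 4) ^+ n < `|D n k w|].
have mA1 n k : measurable (A1 n k) by exact: measurable_norm_gt.
pose A n := \big[setU/set0]_(k < 2 ^ n) A1 n k.
have mA n : measurable (A n) by apply: bigsetU_measurable.
exists (\bigcup_n A n); split.
- exact: bigcupT_measurable.
- rewrite (le_trans (generalized_Boole_inequality _ _ _))//;
  first exact: bigcupT_measurable.
  have PA1 n k : (P (A1 n k) <= (K0 * s ^+ m * ((8 / 9) ^+ 6) ^+ n)%:E)%E.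
    have sn0 : 0 < s / 2 ^+ n by rewrite divr_gt0// exprn_gt0.
    have cn0 : 0 < c * (3 / 4) ^+ n by rewrite mulr_gt0// exprn_gt0.
    have d0 : 0 <= dyadic s n k by rewrite mulr_ge0// ltW.
    have dlt : dyadic s n k < dyadic s n k.+1 by rewrite /dyadic ltr_pM2r// ltr_nat.
    have -> : P (A1 n k) =
      normal_prob 0 (Num.sqrt (s / 2 ^+ n)) [set x | (c * (3 / 4) ^+ n < `|x|)%R].
      have -> : s / 2 ^+ n = dyadic s n k.+1 - dyadic s n k.
        by rewrite /dyadic -natr1; ring.
      rewrite -Binc//.
      exact: (measurable_norm_gt (f := id)).
    have sq0 : 0 < Num.sqrt (s / 2 ^+ n) by rewrite sqrtr_gt0.
    rewrite (le_trans (normal_prob_tail sq0 cn0))// lee_fin.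
    rewrite /K0 -2!(mulrA (Num.sqrt 2)) ler_wpM2l ?sqrtr_ge0//.
    rewrite sqr_sqrtr ?(ltW sn0)//.
    set y := (_ ^+ 2 / _).
    have y0 : 0 < y by rewrite divr_gt0 ?exprn_gt0// mulr_gt0.
    rewrite (le_trans (expRN_le_inv_exp m0 y0))//.
    have -> : m%:R / y = (4 * m%:R / c ^+ 2) * (s * (8 / 9) ^+ n).
      have -> : (8 / 9 : R) ^+ n = (((3 / 4) ^+ n) ^+ 2 * 2 ^+ n)^-1.
        by rewrite -exprM mulnC exprM -exprMn -exprVn; congr (_ ^+ n); field.
      by rewrite /y; field; rewrite !expf_neq0 ?gt_eqF.
    rewrite exprMn -[leRHS]mulrA; apply: ler_wpM2l.
      by apply: exprn_ge0; apply: divr_ge0; [exact: mulr_ge0 | exact: exprn_ge0 (ltW c0)].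
    rewrite exprMn; apply: ler_wpM2l; first exact: exprn_ge0 (ltW s0).
    rewrite -!exprM [(n * m)%N]mulnC; apply: ler_wiXn2l; last
      by rewrite leq_mul2r m6 orbT.
      by lra.
    by lra.
  have PA n : (P (A n) <= (K0 * s ^+ m * z ^+ n)%:E)%E.
    rewrite (le_trans (Boole_inequality _ _))//
      (le_trans (lee_sum _ (fun (k : 'I_(2 ^ n)) _ => PA1 n k)))//.
    rewrite sumEFin lee_fin sumr_const card_ord -[leLHS]mulr_natl natrX /z [(2 * _) ^+
      n]exprMn.
    by rewrite [leLHS]mulrCA.
  rewrite (@le_trans _ _ (\sum_(n <oo) (K0 * s ^+ m * z ^+ n)%:E)%E)//.
    by apply: lee_nneseries => [n _ _|n _]; [exact: measure_ge0|exact: PA].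
  rewrite (le_trans (nneseries_geometric_le _ z01))//.
    by apply: mulr_ge0 => //; exact: exprn_ge0 (ltW s0).
  by rewrite mulrAC.
- move=> w nA cB u us.
  have -> : u = Num.max 0 u by rewrite max_r//; case/andP: us.
  apply: (@dyadic_chaining _ (fun t => B (Num.max 0 t) w) s c) => //.
  + by rewrite maxxx B0.
  + exact: ltW.
  + move=> n k kn; rewrite leNgt; apply/negP => h; apply: nA; exists n => //.
    rewrite /A -bigcup_mkord; exists k => //; rewrite /A1 /D /=.
    by move: h; rewrite !max_r// /dyadic mulr_ge0// divr_ge0// ?ltW// exprn_ge0.
Qed.

(** The unit increments are independent, and each of them is at most a in absolute
    value with the same probability < 1. *)
Lemma brownian_increments_tail (a : R) : 0 <= a ->
  exists2 y : R, 0 < y & forall n : nat,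
    measurable [set w | forall i, (i < n)%N -> `|B i.+1%:R w - B i%:R w| <= a] /\
    (P [set w | forall i, (i < n)%N -> (`|B i.+1%:R w - B i%:R w| <= a)%R]
      <= (expR (- (y * n%:R)))%:E)%E.
Proof.
move=> a0; have [_ _ Binc Bind] := hB.
pose D := [set x : R | `|x| <= a].
have mD : measurable D.
  rewrite (_ : D = ~` [set x | a < `|x|]); first by apply: measurableC;
    exact: (measurable_norm_gt (f := id)).
  apply/seteqP; split => x; rewrite /D/=; first by rewrite leNgt => /negP.
  by move/negP; rewrite -leNgt.
pose q := fine (normal_prob (0:R) 1 D).
have qE : normal_prob (0:R) 1 D = q%:E.
  rewrite fineK// ge0_fin_numE; last exact: (measure_ge0 (normal_prob (0:R) 1)).
  by rewrite (lt_trans (normal_prob_bounded_lt1 a0))// ltry.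
have q1 : q < 1 by rewrite -lte_fin -qE; exact: normal_prob_bounded_lt1.
have q0 : 0 <= q by rewrite fine_ge0//; exact: (measure_ge0 (normal_prob (0:R) 1)).
(* The maximum with 1/2 makes ln q' meaningful whether or not q vanishes. *)
pose q' := Num.max q 2^-1.
have q'01 : 0 < q' < 1 by rewrite lt_max gt_max q1 invr_gt0 ltr0n orbT/= invf_lt1// ltr1n.
have [q'0 q'1] := andP q'01.
exists (- ln q'); first by rewrite oppr_gt0 ln_lt0.
move=> n.
have setE : [set w | forall i, (i < n)%N -> `|B i.+1%:R w - B i%:R w| <= a] =
   \bigcap_(i : 'I_n) ((fun w => B i.+1%:R w - B i%:R w) @^-1` D).
  apply/seteqP; split => [w h i _|w h i ltin]; first exact: h.
  exact: (h (Ordinal ltin) I).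
have mi (i : nat) : measurable ((fun w => B i.+1%:R w - B i%:R w) @^-1` D).
  have mf : measurable_fun setT (fun w => B i.+1%:R w - B i%:R w)
    by apply: measurable_funB.
  by rewrite -[X in measurable X]setTI; exact: mf.
split.
  rewrite (_ : mkset _ = \bigcap_(i in `I_n) ((fun w => B i.+1%:R w - B i%:R w) @^-1` D)).
    by apply: bigcap_measurableType => i _; exact: mi.
  by apply/seteqP; split => w h i; exact: h.
rewrite setE (Bind n (fun i => i%:R)) //; last by move=> i; rewrite ler_nat.
rewrite (eq_bigr (fun=> q%:E)); last first.
  move=> i _; rewrite Binc ?ltr_nat//.
  by rewrite -natr1 addrAC subrr add0r sqrtr1.
rewrite prodEFin lee_fin prodr_const card_ord mulNr opprK expRM_natr lnK ?posrE//.
by rewrite lerXn2r ?nnegrE ?(ltW q'0)// /q' le_max lexx.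
Qed.

End brownian_tails.

(** * Moments of the exit time and of its inverse *)

(** The tail of Y decreases faster than any power. *)
Definition fast_tail {R : realType} {d : measure_display} {T : measurableType d}
    (P : probability T R) (Y : T -> R) : Prop :=
  forall m : nat, exists2 K : R, 0 <= K & forall x : R, 1 <= x ->
    (P [set w | (x <= Y w)%R] <= (K / x ^+ m)%:E)%E.

Section moments.
Context {R : realType} {d : measure_display} {T : measurableType d}.
Variable P : probability T R.

(** Y^N is bounded by 1 plus the sum over n of 2^((n+1) N) on the event
    2^n <= Y. *)
Lemma fast_tail_moment (Y : T -> R) N : measurable_fun setT Y ->
  (forall w, 0 <= Y w) -> fast_tail P Y -> integrableR P (fun w => Y w ^+ N).
Proof.
move=> mY Y0 /(_ N.+1)[K K0 hK].
have mYN : measurable_fun setT (fun w => Y w ^+ N) by exact: measurable_funX.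
pose E n := [set w | 2 ^+ n <= Y w].
have mE n : measurable (E n) by exact: measurable_ge.
pose f n w : \bar R := ((2 ^+ n.+1) ^+ N * \1_(E n) w)%:E.
have f0 n w : (0 <= f n w)%E by rewrite lee_fin mulr_ge0// exprn_ge0// exprn_ge0.
have mf n : measurable_fun setT (f n).
  by apply/measurable_EFinP; apply: measurable_funM => //; exact: measurable_indic.
have key w : ((Y w ^+ N)%:E <= 1%:E + \sum_(n <oo) f n w)%E.
  have [Y1|Y1] := ltP (Y w) 1.
    rewrite -[leLHS]adde0 leeD//; first by rewrite lee_fin exprn_ile1// ltW.
    by apply: nneseries_ge0.
  rewrite -[leLHS]add0e leeD//.
  pose k := Num.truncn (Y w).
  have /andP[k1 k2] := truncn_itv (Y0 w).
  have k0 : (0 < k)%N by rewrite truncn_gt0.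
  (* 2^n <= Y w < 2^(n+1) *)
  pose n := trunc_log 2 k.
  have /andP[n1 n2] := trunc_log_bounds (isT : 1 < 2)%N k0.
  have Yn : Y w <= 2 ^+ n.+1.
    by rewrite (le_trans (ltW k2))// -natrX ler_nat.
  have En : E n w by rewrite /E/= (le_trans _ k1)// -natrX ler_nat.
  apply: (@le_trans _ _ (f n w)).
    rewrite lee_fin indicE mem_set// mulr1 lerXn2r ?nnegrE//.
  apply: (@le_trans _ _ (\sum_(0 <= i < n.+1) f i w)%E).
    by rewrite big_nat_recr//= leeDr// sume_ge0.
  exact: nneseries_lim_ge.
have mg : measurable_fun setT (fun w => \sum_(n <oo) f n w)%E.
  exact: (@ge0_emeasurable_sum _ _ _ _ f xpredT).
apply/integrableP; split; first exact/measurable_EFinP.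
apply: (@le_lt_trans _ _ (\int[P]_w (1%:E + \sum_(n <oo) f n w))%E).
  apply: ge0_le_integral => //.
  - by apply: measurableT_comp => //; exact/measurable_EFinP.
  - exact: emeasurable_funD.
  - by move=> w _; rewrite /= ger0_norm ?exprn_ge0.
rewrite ge0_integralD//; last by move=> w _; apply: nneseries_ge0.
rewrite integral_cst// mul1e integral_nneseries//.
have half : 0 < (2^-1 : R) < 1 by rewrite invr_gt0 ltr0n/= invf_lt1// ltr1n.
apply: (@le_lt_trans _ _ (1%:E + \sum_(n <oo) ((K * 2 ^+ N) * 2^-1 ^+ n)%:E)%E).
  rewrite leeD//; first exact: probability_le1.
  apply: lee_nneseries => [n _ _|n _]; first exact: integral_ge0.
  rewrite /f; under eq_integral do rewrite EFinM.
  rewrite ge0_integralZl_EFin//; last first.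
    by apply/measurable_EFinP; exact: measurable_indic.
  rewrite integral_indic// setIT.
  have n1 : 1 <= 2 ^+ n :> R by rewrite exprn_ege1// ler1n.
  rewrite (le_trans (lee_wpmul2l _ (hK _ n1)))//.
  rewrite -EFinM lee_fin [2 ^+ n.+1]exprS exprMn [_ ^+ N.+1]exprSr exprVn.
  set t := 2 ^+ n; have t0 : t != 0 by rewrite expf_neq0.
  rewrite le_eqVlt; apply/orP; left; apply/eqP; field.
  by rewrite t0 expf_neq0.
rewrite (@le_lt_trans _ _ (1%:E + (K * 2 ^+ N / (1 - 2^-1))%:E)%E)//.
  by rewrite leeD2l// nneseries_geometric_le// mulr_ge0.
by rewrite -EFinD ltry.
Qed.

End moments.

Section exit_tails.
Context {R : realType} {d : measure_display} {T : measurableType d}.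
Variables (P : probability T R) (X Y : R -> {RV P >-> R}).
Hypotheses (hX : standard_BM X) (hY : standard_BM Y).
Variables (V : set (R * R)) (rho c : R).
Hypotheses (oV : open V) (c0 : 0 < c) (rho0 : 0 <= rho)
  (Vrho : forall z, V z -> `|z.1| <= rho)
  (Vc : forall z, `|z.1| <= 4 * c -> `|z.2| <= 4 * c -> V z).

(** The process B with its value at time 0 extended to negative times. *)
Definition from0 (B : R -> {RV P >-> R}) (t : R) (w : T) : R := B (Num.max 0 t) w.

Lemma continuous_from0 (B : R -> {RV P >-> R}) : standard_BM B ->
  forall w, continuous (from0 B ^~ w).
Proof. by move=> [_ cB _ _] w; exact: continuous_stopped_at0 (cB w). Qed.

Let tau := first_exit (from0 X) (from0 Y) V.
Let t w := fine (tau w).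

Lemma measurable_tau : measurable_fun setT tau.
Proof. by apply: measurable_first_exit => //; exact: continuous_from0. Qed.

Lemma measurable_tau_ge (x : R) : measurable [set w | (x%:E <= tau w)%E].
Proof.
rewrite (_ : mkset _ = tau @^-1` `[x%:E, +oo[%classic).
  rewrite -[X in measurable X]setTI; apply: measurable_tau => //.
  exact: emeasurable_itv.
by apply/seteqP; split => w /=; rewrite in_itv/= andbT.
Qed.

Lemma measurable_tau_lt (x : R) : measurable [set w | (tau w < x%:E)%E].
Proof.
rewrite (_ : mkset _ = ~` [set w | (x%:E <= tau w)%E]).
  by apply: measurableC; exact: measurable_tau_ge.
by apply/seteqP; split => w /=; rewrite ltNge => /negP.
Qed.

(** If the exit occurs after n + 1, then the n first unit increments of X are
    bounded by twice the bound rho of V. *)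
Lemma tau_fin_tail : exists2 y, 0 < y & forall n : nat,
  (P [set w | (n.+1%:R%:E <= tau w)%E] <= (expR (- (y * n%:R)))%:E)%E.
Proof.
have a0 : 0 <= 2 * rho by rewrite mulr_ge0.
have [y y0 hy] := brownian_increments_tail hX a0.
exists y => // n; have [mE PE] := hy n.
apply: le_trans PE; apply: le_measure; rewrite ?inE//.
  exact: measurable_tau_ge.
move=> w /= /first_exit_ge h i ltin.
have hi (j : nat) : (j <= n)%N -> `|X j%:R w| <= rho.
  move=> jn; have := h j%:R; rewrite ler0n ltr_nat ltnS jn => /(_ isT isT)/Vrho/=.
  by rewrite /from0 max_r.
by rewrite (le_trans (ler_normB _ _))// mulrDl !mul1r lerD// hi// ltnW.
Qed.

Lemma tau_small_tail (m : nat) : (6 <= m)%N ->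
  exists2 K : R, 0 <= K & forall s, 0 < s -> (P [set w | (tau w < s%:E)%E] <=
    (K * s ^+ m)%:E)%E.
Proof.
move=> m6.
have [K1 K10 h1] := brownian_sup_tail hX c0 m6.
have [K2 K20 h2] := brownian_sup_tail hY c0 m6.
exists (K1 + K2); first exact: addr_ge0.
move=> s s0; have [A [mA PA hA]] := h1 s s0; have [B [mB PB hB]] := h2 s s0.
apply: (@le_trans _ _ (P (A `|` B))).
  apply: le_measure; rewrite ?inE//.
  - exact: measurable_tau_lt.
  - exact: measurableU.
  - move=> w /= ts; apply: contrapT => /not_orP[nA nB].
    move: ts; rewrite ltNge => /negP; apply; apply/first_exit_ge => u u0 us.
    have us' : 0 <= u <= s by rewrite u0 ltW.
    apply: Vc; rewrite /from0 max_r//=.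
      by apply: hA us' => //; exact: continuous_from0.
    by apply: hB us' => //; exact: continuous_from0.
by rewrite (le_trans (measureU2 _ _ _))// mulrDl EFinD leeD.
Qed.

Lemma tau_finite_ae : P [set w | tau w = +oo%E] = 0%E.
Proof.
have [y y0 hy] := tau_fin_tail.
have moo : measurable [set w | tau w = +oo%E].
  rewrite (_ : mkset _ = tau @^-1` [set +oo%E])//.
  by rewrite -[X in measurable X]setTI; apply: measurable_tau.
apply/eqP; rewrite eq_le measure_ge0 andbT; apply/lee_addgt0Pr => e e0.
rewrite add0e.
(* exp (- y (n + 1)) <= 1 / (y (n + 1)) <= e for this n *)
pose n := Num.truncn (y * e)^-1.
apply: (@le_trans _ _ (expR (- (y * n.+1%:R)))%:E).
  apply: le_trans (hy n.+1); apply: le_measure; rewrite ?inE//;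
    first exact: measurable_tau_ge.
  by move=> w /= ->; rewrite leey.
have yn : 0 < y * n.+1%:R by rewrite mulr_gt0.
rewrite lee_fin (le_trans (@expRN_le_inv_exp _ 1 _ _ _))// expr1 div1r.
rewrite invf_ple ?posrE// -ler_pdivrMl// -invfM mulrC.
by rewrite ltW// /n mulrC truncnS_gt.
Qed.

Lemma tau_ge0 w : (0 <= tau w)%E.
Proof. exact: first_exit_ge0. Qed.

Lemma tau_gt0 w : (0 < tau w)%E.
Proof.
rewrite lt_neqAle tau_ge0 andbT; apply/eqP => t0.
have := first_exit_notin (continuous_from0 hX) (continuous_from0 hY) oV (w := w).
rewrite -/(tau w) -t0 => /(_ (ltry _)); apply; apply: Vc; rewrite /from0 /= maxxx.
  by case: hX => -> _ _ _; rewrite normr0 mulr_ge0// ltW.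
by case: hY => -> _ _ _; rewrite normr0 mulr_ge0// ltW.
Qed.

Lemma measurable_exit_time : measurable_fun setT t.
Proof. by apply: measurableT_comp => //; exact: measurable_tau. Qed.

Lemma exit_time_ge0 w : 0 <= t w.
Proof. by rewrite fine_ge0// tau_ge0. Qed.

Lemma measurable_inv_exit_time : measurable_fun setT (fun w => (t w)^-1).
Proof.
by apply: measurable_funV_ge0 => [w|]; [exact: exit_time_ge0|exact: measurable_exit_time].
Qed.

Lemma exit_time_fast_tail : fast_tail P t.
Proof.
move=> m; have [y y0 hy] := tau_fin_tail.
exists (expR (2 * y) * (m.+1%:R / y) ^+ m.+1).
  by rewrite mulr_ge0 ?expR_ge0// exprn_ge0// divr_ge0// ltW.
move=> x x1; have x0 : 0 < x by rewrite (lt_le_trans _ x1).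
pose k := Num.truncn x.
have k0 : (0 < k)%N by rewrite truncn_gt0.
have /andP[k1 k2] := truncn_itv (ltW x0).
apply: (@le_trans _ _ (expR (- (y * k.-1%:R)))%:E).
  apply: le_trans (hy k.-1); apply: le_measure; rewrite ?inE//.
  - by apply: measurable_ge; exact: measurable_exit_time.
  - exact: measurable_tau_ge.
  - move=> w /= xt; rewrite prednK//.
    have [->|ty] := eqVneq (tau w) +oo%E; first exact: leey.
    have -> : tau w = (t w)%:E by rewrite fineK// ge0_fin_numE ?tau_ge0// ltey.
    by rewrite lee_fin (le_trans k1).
rewrite lee_fin -mulrA.
rewrite (@le_trans _ _ (expR (2 * y) * expR (- (y * x))))//.
  have kE : k.-1%:R = k%:R - 1 :> R by rewrite -[in RHS](prednK k0) -natr1 addrK.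
  rewrite -expRD ler_expR kE; move: k2; rewrite -natr1 => /ltW /(ler_wpM2l (ltW y0)).
  by rewrite -/k mulrDr mulr1 mulrBr; lra.
rewrite ler_wpM2l ?expR_ge0// (le_trans (@expRN_le_inv_exp _ m.+1 _ _ _))// ?mulr_gt0//.
rewrite invfM mulrA exprMn ler_wpM2l//.
  by rewrite exprn_ge0// divr_ge0// ltW.
by rewrite exprVn lef_pV2 ?posrE ?exprn_gt0// ler_weXn2l.
Qed.

Lemma inv_exit_time_fast_tail : fast_tail P (fun w => (t w)^-1).
Proof.
move=> m; pose k := (m + 6)%N.
have [K K0 hK] := tau_small_tail (leq_addl m 6).
exists (K * 2 ^+ k); first by rewrite mulr_ge0.
move=> x x1; have x0 : 0 < x by rewrite (lt_le_trans _ x1).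
have x20 : 0 < 2 / x by rewrite divr_gt0.
apply: (@le_trans _ _ (P [set w | (tau w < (2 / x)%:E)%E])).
  apply: le_measure; rewrite ?inE//.
  - by apply: measurable_ge; exact: measurable_inv_exit_time.
  - exact: measurable_tau_lt.
  - move=> w /= xt.
    (* t w = 0 if tau w = +oo, but here its inverse is positive. *)
    have t0 : 0 < t w by rewrite -invr_gt0 (lt_le_trans x0).
    have ty : tau w != +oo%E.
      by apply/eqP => ty; move: t0; rewrite /t ty ltxx.
    have -> : tau w = (t w)%:E by rewrite fineK// ge0_fin_numE ?tau_ge0// ltey.
    rewrite lte_fin ltr_pdivlMr// (le_lt_trans (ler_wpM2l (ltW t0) xt))//.
    by rewrite divff ?gt_eqF// ltr1n.
rewrite (le_trans (hK _ x20))// lee_fin exprMn mulrA ler_wpM2l ?mulr_ge0//.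
rewrite exprVn lef_pV2 ?posrE ?exprn_gt0// ler_weXn2l//.
by rewrite leq_addr.
Qed.

End exit_tails.

(** * The Borel structure of the complex plane *)

Section complex_plane.
Local Open Scope complex_scope.

Lemma normc_nonneg {R : realType} (z : R[i]) : 0 <= Normc.normc z.
Proof. by case: z => a b; rewrite /= sqrtr_ge0. Qed.

Lemma normc_sqr {R : realType} (z : R[i]) :
  Normc.normc z ^+ 2 = complex.Re z ^+ 2 + complex.Im z ^+ 2.
Proof. by case: z => a b; rewrite /= sqr_sqrtr// addr_ge0 ?sqr_ge0. Qed.

Lemma normc_le_sum {R : realType} (a b : R) : Normc.normc (a +i* b) <= `|a| + `|b|.
Proof.
rewrite -(@ler_pXn2r _ 2)// ?nnegrE ?normc_nonneg ?addr_ge0// normc_sqr /=.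
rewrite sqrrD !real_normK ?num_real// -addrA lerD2l lerDr.
by rewrite mulrn_wge0// mulr_ge0.
Qed.

Lemma normc_ge_Re {R : realType} (z : R[i]) : `|complex.Re z| <= Normc.normc z.
Proof.
rewrite -(@ler_pXn2r _ 2)// ?nnegrE ?normc_nonneg// normc_sqr real_normK ?num_real//.
by rewrite lerDl sqr_ge0.
Qed.

Lemma normc_ge_Im {R : realType} (z : R[i]) : `|complex.Im z| <= Normc.normc z.
Proof.
rewrite -(@ler_pXn2r _ 2)// ?nnegrE ?normc_nonneg// normc_sqr real_normK ?num_real//.
by rewrite lerDr sqr_ge0.
Qed.

(** Neighbourhoods in R[i], whose norm has its values in R[i], in terms of the
    modulus as an element of R. *)
Lemma complex_nbhsP {R : realType} (z : R[i]) (W : set R[i]) :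
  nbhs z W <-> exists2 r : R, 0 < r & forall y, Normc.normc (z - y) < r -> W y.
Proof.
split.
  move=> /nbhs_ballP[[r i] /=]; rewrite ltcE/= => /andP[/eqP -> r0] hr.
  exists r => // y zy; apply: hr; rewrite /ball/=.
  by rewrite (_ : `|z - y| = (Normc.normc (z - y))%:C)// -[_ +i* _]/(r%:C) ltcR.
move=> [r r0 hr]; apply/nbhs_ballP; exists r%:C => /=; first by rewrite ltcR.
move=> y; rewrite /ball/= (_ : `|z - y| = (Normc.normc (z - y))%:C)// ltcR.
exact: hr.
Qed.

Lemma complex_pair_continuous {R : realType} :
  continuous (fun z : R * R => z.1 +i* z.2 : R[i]).
Proof.
move=> [x y] W /= /complex_nbhsP[r r0 hr].
apply/nbhs_ballP; exists (r / 2) => /=; first by rewrite divr_gt0.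
move=> [x' y'] [/= xx' yy']; apply: hr => /=.
apply: (le_lt_trans (normc_le_sum (x - x') (y - y'))).
by rewrite (splitr r) ltrD.
Qed.

Lemma Re_continuous {R : realType} : continuous (fun z : R[i] => complex.Re z : R).
Proof.
move=> z W /= /nbhs_ballP[r /= r0 hr]; apply/complex_nbhsP; exists r => // y zy.
apply: hr; rewrite /ball/= (le_lt_trans _ zy)//.
by case: z y {zy} => a b [a' b']; exact: (normc_ge_Re ((a - a') +i* (b - b'))).
Qed.

Lemma Im_continuous {R : realType} : continuous (fun z : R[i] => complex.Im z : R).
Proof.
move=> z W /= /nbhs_ballP[r /= r0 hr]; apply/complex_nbhsP; exists r => // y zy.
apply: hr; rewrite /ball/= (le_lt_trans _ zy)//.
by case: z y {zy} => a b [a' b']; exact: (normc_ge_Im ((a - a') +i* (b - b'))).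
Qed.

Lemma borelC_measurable_fun {R : realType} (f : R[i] -> R) :
  continuous f -> measurable_fun setT (f : borelC R -> R).
Proof.
move=> cf; apply: (measurability _ (RGenOpens.measurableE R)) => //.
move=> _ [_ [a [b ->]] <-].
rewrite setTI; apply: sub_sigma_algebra.
by apply: open_comp => // x _; exact: cf.
Qed.

Lemma measurable_borelC_pair {R : realType} {d} {T : measurableType d} (f g : T -> R) :
  measurable_fun setT f -> measurable_fun setT g ->
  measurable_fun setT ((fun w => f w +i* g w) : T -> borelC R).
Proof.
move=> mf mg; apply: (@measurability _ _ T (borelC R) setT _ (@open R[i])) => //.
move=> _ [W oW <-]; rewrite setTI.
apply: (@open_preimage_measurable _ _ _ f g ((fun z : R * R
  => z.1 +i* z.2 : R[i]) @^-1` W)) => //.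
by apply: open_comp => // x _; exact: complex_pair_continuous.
Qed.

Lemma measurable_Re {R : realType} :
  measurable_fun setT ((fun z : R[i] => complex.Re z) : borelC R -> R).
Proof. exact: borelC_measurable_fun Re_continuous. Qed.

Lemma measurable_Im {R : realType} :
  measurable_fun setT ((fun z : R[i] => complex.Im z) : borelC R -> R).
Proof. exact: borelC_measurable_fun Im_continuous. Qed.

Lemma measurable_normc {R : realType} :
  measurable_fun setT (@Normc.normc R : borelC R -> R).
Proof.
rewrite (_ : @Normc.normc R =
  (fun z : borelC R => (complex.Re z ^+ 2 + complex.Im z ^+ 2) `^ 2^-1)).
  apply: (measurableT_comp (measurable_powR _)).
  by apply: measurable_funD; apply: measurable_funX;
    [exact: measurable_Re|exact: measurable_Im].
apply/funext => -[a b] /=; rewrite powR12_sqrt// addr_ge0// sqr_ge0//.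
Qed.

Lemma bounded_complexP {R : realType} (U : set R[i]) : bounded_set U ->
  exists2 rho : R, 0 <= rho & forall z, U z -> Normc.normc z <= rho.
Proof.
move=> [M [Mreal hM]].
pose M1 : R[i] := `|M| + 1.
have MM1 : M < M1 by rewrite (le_lt_trans (real_ler_norm Mreal))// ltrDl.
have M1E : M1 = (Normc.normc M + 1)%:C.
  by rewrite /M1 (_ : `|M| = (Normc.normc M)%:C)// rmorphD.
exists (Normc.normc M + 1); first by rewrite addr_ge0// normc_nonneg.
move=> z Uz; rewrite -lecR -M1E; exact: (hM _ MM1 z Uz).
Qed.

End complex_plane.

Section exit_pair_properties.
Local Open Scope complex_scope.
Context {R : realType} {d : measure_display} {T : measurableType d}.
Variables (P : probability T R) (Z : R -> T -> R[i]) (U : set R[i]).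
Hypotheses (hZ : planar_BM P Z) (oU : open U) (bU : bounded_set U) (U0 : U 0).

Let E := exit_pair Z U.

(** The values taken almost surely by the exit pair: a position between two
    circles centred at 0, and a positive time. *)
Definition good_exit (r rho : R) : set (borelC R * R) :=
  [set z | [/\ r <= Normc.normc z.1, Normc.normc z.1 <= rho & 0 < z.2]].

Lemma measurable_good_exit r rho : measurable (good_exit r rho).
Proof.
have mN : measurable_fun setT (fun z : borelC R * R => Normc.normc z.1).
  exact: measurableT_comp measurable_normc measurable_fst.
rewrite (_ : good_exit r rho =
  (fun z : borelC R * R => Normc.normc z.1) @^-1` `[r, rho] `&` snd @^-1` `]0, +oo[).
  apply: measurableI; rewrite -[X in measurable X]setTI.
    by apply: mN => //; exact: measurable_itv.
  by apply: measurable_snd => //; exact: measurable_itv.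
apply/seteqP; split => z /=; rewrite !in_itv/= andbT.
  by move=> [h1 h2 h3]; split => //; apply/andP.
by move=> [/andP[h1 h2] h3].
Qed.

(** All that is needed of Brownian motion. The boundedness of U gives the upper
    bound on the position and the tail of the time; a disc around 0 contained in U
    gives the lower bound on the position and the tail of the inverse time. *)
Lemma exit_pair_properties :
  measurable_fun setT E /\
  (exists r rho : R, [/\ 0 < r, 0 < rho & P (E @^-1` (~` good_exit r rho)) = 0%E]) /\
  [/\ fast_tail P (fun w => (E w).2), fast_tail P (fun w => (E w).2^-1)
    & forall w, 0 <= (E w).2].
Proof.
have [X [Y [hX hY indep ZE]]] := hZ.
pose V := (fun z : R * R => z.1 +i* z.2 : R[i]) @^-1` U.
have oV : open V by apply: open_comp => // x _; exact: complex_pair_continuous.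
have [rho rho0 hrho] := bounded_complexP bU.
have [r r0 hr] : exists2 r : R, 0 < r & forall y : R[i], Normc.normc y < r -> U y.
  have /complex_nbhsP[r r0 hr] : nbhs (0 : R[i]) U by exact: open_nbhs_nbhs.
  exists r => // y yr; apply: hr; rewrite sub0r.
  by case: y yr => a b /=; rewrite !sqrrN.
(* |x| and |y| at most 4 c = r / 4 give a modulus smaller than r. *)
pose c := r / 16.
have c0 : 0 < c by rewrite divr_gt0.
have Vrho z : V z -> `|z.1| <= rho.
  by move=> /hrho; apply: le_trans; exact: (normc_ge_Re (z.1 +i* z.2)).
have Vrho2 z : V z -> `|z.2| <= rho.
  by move=> /hrho; apply: le_trans; exact: (normc_ge_Im (z.1 +i* z.2)).
have Vc z : `|z.1| <= 4 * c -> `|z.2| <= 4 * c -> V z.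
  move=> z1 z2; apply: hr; rewrite (le_lt_trans (normc_le_sum _ _))//.
  by rewrite (le_lt_trans (lerD z1 z2))// /c; lra.
pose tau := first_exit (from0 X) (from0 Y) V.
have ZE' t w : 0 <= t -> Z t w = from0 X t w +i* from0 Y t w.
  by move=> t0; rewrite ZE// /from0 max_r.
have tauE w : exit_time Z U w = tau w.
  rewrite /exit_time /tau /first_exit; congr ereal_inf; congr (_ @` _).
  by apply/seteqP; split=> t /= [t0 nU]; split=> //; move: nU; rewrite /V/= ZE'.
have cX := continuous_from0 hX; have cY := continuous_from0 hY.
pose t w := fine (tau w).
have EE w : E w = (from0 X (t w) w +i* from0 Y (t w) w : borelC R, t w).
  by rewrite /E /exit_pair tauE -/(t w) ZE'// fine_ge0// first_exit_ge0.
have EE' : E = (fun w => (from0 X (t w) w +i* from0 Y (t w) w : borelC R, t w)).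
  exact/funext.
have mt : measurable_fun setT t by exact: (measurable_exit_time hX hY oV).
have mE : measurable_fun setT E.
  rewrite EE'; apply: measurable_fun_pair => //.
  by apply: measurable_borelC_pair; apply: measurable_fun_random_time => // u;
    rewrite /from0.
split=> //; split.
- exists r, (rho + rho + 1); split => //; first by rewrite ltr_wpDl// addr_ge0.
  have moo : measurable [set w | tau w = +oo%E].
    rewrite (_ : mkset _ = tau @^-1` [set +oo%E])//.
    by rewrite -[X in measurable X]setTI; apply: (measurable_tau hX hY oV).
  apply/eqP; rewrite eq_le measure_ge0 andbT -(tau_finite_ae hX hY oV rho0 Vrho).
  apply: le_measure; rewrite ?inE//.
    rewrite -[X in measurable X]setTI; apply: mE => //.
    by apply: measurableC; exact: measurable_good_exit.
  move=> w /= bad; apply: contrapT => /eqP ty; apply: bad.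
  have toy : (tau w < +oo)%E by rewrite ltey.
  have tE : ((t w)%:E = tau w)%E by rewrite fineK// ge0_fin_numE// first_exit_ge0.
  have t0 : 0 < t w by rewrite -lte_fin tE (tau_gt0 hX hY oV c0 Vc).
  have nV := first_exit_notin cX cY oV toy.
  rewrite EE /good_exit/=; split => //.
    by rewrite leNgt; apply/negP => h; apply: nV; apply: hr.
  have bnd (W : set (R * R)) : open W -> (forall z, V z -> ~ W z) ->
     ~ W (from0 X (t w) w, from0 Y (t w) w).
    move=> oW VW WZ.
    by have [u [/VW]] := first_exit_adherent cX cY oW t0 WZ.
  have b1 : `|from0 X (t w) w| <= rho.
    rewrite leNgt; apply/negP.
    apply: (bnd [set z : R * R | rho < `|z.1|]).
      apply: (@open_comp _ _ (fun z : R * R => `|z.1|) [set x | rho < x]);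
        last exact: open_gt.
      by move=> z _; apply: cvg_norm; exact: cvg_fst.
    by move=> z /Vrho; rewrite /= leNgt => /negP.
  have b2 : `|from0 Y (t w) w| <= rho.
    rewrite leNgt; apply/negP.
    apply: (bnd [set z : R * R | rho < `|z.2|]).
      apply: (@open_comp _ _ (fun z : R * R => `|z.2|) [set x | rho < x]);
        last exact: open_gt.
      by move=> z _; apply: cvg_norm; exact: cvg_snd.
    by move=> z /Vrho2; rewrite /= leNgt => /negP.
  by rewrite (le_trans (normc_le_sum _ _))// (le_trans (lerD b1 b2))// lerDl.
- rewrite EE'; split => /=.
  + exact: (exit_time_fast_tail hX hY oV rho0 Vrho).
  + exact: (inv_exit_time_fast_tail hX hY oV c0 Vc).
  + by move=> w; exact: exit_time_ge0.
Qed.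

End exit_pair_properties.

(** * The cost of a coupling as a function of the scale *)

Section complex_identities.
Local Open Scope complex_scope.

Lemma sqr_powR_half {R : realType} (x p : R) : 0 <= x -> (x ^+ 2) `^ (p / 2) = x `^ p.
Proof.
by move=> x0; rewrite -powR_mulrn// -powRrM mulrCA divff// mulr1.
Qed.

(** The law of cosines. *)
Lemma normc_subZ_sqr {R : realType} (z w : R[i]) (l : R) :
  Normc.normc (z - l%:C * w) ^+ 2 =
  Normc.normc z ^+ 2 - 2 * l * cdot w z + l ^+ 2 * Normc.normc w ^+ 2.
Proof.
rewrite /cdot !normc_sqr; case: z => a b; case: w => c e /=; ring.
Qed.

Lemma norm_cdot_le {R : realType} (z w : R[i]) :
  `|cdot z w| <= 2 * (Normc.normc z * Normc.normc w).
Proof.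
have -> : cdot z w = complex.Re z * complex.Re w + complex.Im z * complex.Im w.
  by rewrite /cdot; case: z => a b; case: w => c e /=; ring.
rewrite (le_trans (ler_normD _ _))// !normrM mulrDl !mul1r.
by rewrite lerD// ler_pM// ?normc_ge_Re// normc_ge_Im.
Qed.

End complex_identities.

Section coupling.
Local Open Scope complex_scope.
Context {R : realType}.
Variable pi : probability ((borelC R * R) * (borelC R * R))%type R.
Variables (p r rho : R).
Hypotheses (p2 : 2 <= p) (r0 : 0 < r) (rho0 : 0 < rho).

Notation W := ((borelC R * R) * (borelC R * R))%type.

(** The pairs of points ((xi, theta), (xi', theta')) both of which are good. *)
Definition good_pair : set W :=
  fst @^-1` (good_exit r rho) `&` snd @^-1` (good_exit r rho).

Hypothesis G0 : pi (~` good_pair) = 0%E.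
Hypotheses (ft1 : fast_tail pi (fun w => `|w.1.2|))
  (ft2 : fast_tail pi (fun w => `|w.2.2|))
  (ft3 : fast_tail pi (fun w => `|w.2.2|^-1)).

Let norm_xi1 (w : W) := Normc.normc w.1.1.
Let norm_xi2 (w : W) := Normc.normc w.2.1.
Let dot_xi (w : W) := cdot (w.2.1 : R[i]) w.1.1.
Let q := p / 2.

Lemma measurable_good_pair : measurable good_pair.
Proof.
apply: measurableI; rewrite -[X in measurable X]setTI.
  by apply: measurable_fst => //; exact: measurable_good_exit.
by apply: measurable_snd => //; exact: measurable_good_exit.
Qed.

Lemma measurable_norm_xi1 : measurable_fun setT norm_xi1.
Proof.
exact: (measurableT_comp measurable_normc (measurableT_comp measurable_fst
  measurable_fst)).
Qed.

Lemma measurable_norm_xi2 : measurable_fun setT norm_xi2.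
Proof.
exact: (measurableT_comp measurable_normc (measurableT_comp measurable_fst
  measurable_snd)).
Qed.

Lemma measurable_theta1 : measurable_fun setT (fun w : W => w.1.2).
Proof. exact: (measurableT_comp measurable_snd measurable_fst). Qed.

Lemma measurable_theta2 : measurable_fun setT (fun w : W => w.2.2).
Proof. exact: (measurableT_comp measurable_snd measurable_snd). Qed.

Lemma measurable_dot_xi : measurable_fun setT dot_xi.
Proof.
have mxi1 : measurable_fun setT (fun w : W => w.1.1)
  by exact: (measurableT_comp measurable_fst measurable_fst).
have mxi2 : measurable_fun setT (fun w : W => w.2.1)
  by exact: (measurableT_comp measurable_fst measurable_snd).
rewrite (_ : dot_xi = (fun w => complex.Re (w.2.1 : R[i]) * complex.Re (w.1.1 : R[i])
   + complex.Im (w.2.1 : R[i]) * complex.Im (w.1.1 : R[i]))).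
  apply: measurable_funD; apply: measurable_funM.
  - exact: (measurableT_comp measurable_Re mxi2).
  - exact: (measurableT_comp measurable_Re mxi1).
  - exact: (measurableT_comp measurable_Im mxi2).
  - exact: (measurableT_comp measurable_Im mxi1).
apply/funext => -[[[a b] t] [[a' b'] t']]; rewrite /dot_xi /cdot /=; ring.
Qed.

(** The functions h, a, b of the two summands |xi'|^p |1 + a e + b e^2|^q and
    theta'^q |1 + a e + b e^2|^q of the cost. They have the intended values on the
    good pairs only; the weights h vanish elsewhere. *)
Definition xi_weight (w : W) : R := \1_good_pair w * norm_xi2 w `^ p.
(** - 2 xi'.xi / |xi'|^2. *)
Definition xi_lin (w : W) : R := - (2 * dot_xi w * (norm_xi2 w ^+ 2)^-1).
(** |xi|^2 / |xi'|^2. *)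
Definition xi_quad (w : W) : R := norm_xi1 w ^+ 2 * (norm_xi2 w ^+ 2)^-1.
(** theta'^q on the good pairs. *)
Definition theta_weight (w : W) : R := \1_good_pair w * `|w.2.2| `^ q.
(** The times enter the cost with even powers of e only. *)
Definition theta_lin (w : W) : R := 0.
(** - theta / theta'. *)
Definition theta_quad (w : W) : R := - (`|w.1.2| * `|w.2.2|^-1).

Let mG := measurable_good_pair.

Lemma measurable_xi_weight : measurable_fun setT xi_weight.
Proof.
apply: measurable_funM; first exact: measurable_indic.
exact: (measurableT_comp (measurable_powR p) measurable_norm_xi2).
Qed.

Lemma measurable_inv_norm_xi2 : measurable_fun setT (fun w => (norm_xi2 w ^+ 2)^-1).
Proof.
apply: measurable_funV_ge0 => [w|]; first exact: sqr_ge0.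
by apply: measurable_funX; exact: measurable_norm_xi2.
Qed.

Lemma measurable_xi_lin : measurable_fun setT xi_lin.
Proof.
apply: measurableT_comp => //; apply: measurable_funM measurable_inv_norm_xi2.
by apply: measurable_funM => //; exact: measurable_dot_xi.
Qed.

Lemma measurable_xi_quad : measurable_fun setT xi_quad.
Proof.
apply: measurable_funM measurable_inv_norm_xi2.
by apply: measurable_funX; exact: measurable_norm_xi1.
Qed.

Lemma measurable_theta_weight : measurable_fun setT theta_weight.
Proof.
apply: measurable_funM; first exact: measurable_indic.
apply: (measurableT_comp (measurable_powR q)).
by apply: measurableT_comp => //; exact: measurable_theta2.
Qed.

Lemma measurable_theta_quad : measurable_fun setT theta_quad.
Proof.
apply: measurableT_comp => //; apply: measurable_funM.
  by apply: measurableT_comp => //; exact: measurable_theta1.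
apply: measurable_funV_ge0 => //.
by apply: measurableT_comp => //; exact: measurable_theta2.
Qed.

Lemma xi_weight_ge0 w : 0 <= xi_weight w.
Proof. by rewrite mulr_ge0// powR_ge0. Qed.

Lemma theta_weight_ge0 w : 0 <= theta_weight w.
Proof. by rewrite mulr_ge0// powR_ge0. Qed.

Lemma integrableR_cst (k : R) : integrableR pi (fun=> k).
Proof. exact: finite_measure_integrable_cst. Qed.

Lemma integrable_xi_moments i j :
  integrableR pi (fun w => xi_weight w * `|xi_lin w| ^+ i * `|xi_quad w| ^+ j).
Proof.
apply: (integrableR_le (g :=
  fun=> rho `^ p * (2 * (2 * (rho * rho)) * (r ^+ 2)^-1) ^+ i * (rho ^+ 2 * (r ^+
    2)^-1) ^+ j)); last exact: integrableR_cst.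
  apply: measurable_funM; [apply: measurable_funM; first exact: measurable_xi_weight|].
    by apply: measurable_funX; apply: measurableT_comp => //; exact: measurable_xi_lin.
  by apply: measurable_funX; apply: measurableT_comp => //; exact: measurable_xi_quad.
have r20 : 0 < r ^+ 2 by rewrite exprn_gt0.
have rhoge0 : 0 <= rho by exact: ltW.
move=> w; rewrite ger0_norm; last first.
    by apply: mulr_ge0; [apply: mulr_ge0;
      [exact: xi_weight_ge0|exact: exprn_ge0]|exact: exprn_ge0].
rewrite /xi_weight indicE; have [wG|_] := boolP (w \in good_pair); last first.
  by rewrite !mul0r !mulr_ge0 ?powR_ge0 ?exprn_ge0 ?mulr_ge0 ?invr_ge0 ?(ltW r20) ?(ltW
    rho0) ?sqr_ge0.
move: wG; rewrite inE => -[[/= rx xrho _] [/= ry yrho _]].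
have ny0 : 0 < norm_xi2 w by rewrite (lt_le_trans r0).
have nV : (norm_xi2 w ^+ 2)^-1 <= (r ^+ 2)^-1.
  by rewrite lef_pV2 ?posrE ?exprn_gt0// lerXn2r ?nnegrE// ltW.
have nV0 : 0 <= (norm_xi2 w ^+ 2)^-1 by rewrite invr_ge0 sqr_ge0.
rewrite mul1r; apply: ler_pM; rewrite ?mulr_ge0 ?powR_ge0 ?exprn_ge0//.
  apply: ler_pM; rewrite ?powR_ge0 ?exprn_ge0//.
    apply: (ge0_ler_powR (le_trans (ler0n R 2) p2));
      rewrite ?nnegrE ?(ltW ny0) ?(ltW rho0) //.
  apply: lerXn2r; rewrite ?nnegrE ?mulr_ge0 ?(ltW rho0) ?invr_ge0 ?(ltW r20)//.
  rewrite /xi_lin normrN normrM (ger0_norm nV0); apply: ler_pM => //.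
  rewrite normrM ger0_norm// (le_trans (ler_wpM2l _ (norm_cdot_le _ _)))//.
  do 2 apply: ler_wpM2l => //.
  by apply: ler_pM => //; exact: normc_nonneg.
apply: lerXn2r; rewrite ?nnegrE ?mulr_ge0 ?sqr_ge0 ?invr_ge0 ?(ltW r20)//.
rewrite /xi_quad normrM (ger0_norm nV0) normrX ger0_norm ?normc_nonneg//.
apply: ler_pM => //; first by rewrite exprn_ge0// normc_nonneg.
by apply: lerXn2r => //; rewrite nnegrE ?normc_nonneg// ltW.
Qed.

Lemma prod3_le (x y z : R) : 0 <= x -> 0 <= y -> 0 <= z ->
  x * y * z <= x ^+ 3 + y ^+ 3 + z ^+ 3.
Proof.
move=> x0 y0 z0; pose m := Num.max x (Num.max y z).
have xm : x <= m by rewrite le_max lexx.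
have ym : y <= m by rewrite !le_max lexx orbT.
have zm : z <= m by rewrite !le_max lexx !orbT.
have m3 : m ^+ 3 <= x ^+ 3 + y ^+ 3 + z ^+ 3.
  have x3 : 0 <= x ^+ 3 by rewrite exprn_ge0.
  have y3 : 0 <= y ^+ 3 by rewrite exprn_ge0.
  have z3 : 0 <= z ^+ 3 by rewrite exprn_ge0.
  rewrite /m; have [_|_] := leP x (Num.max y z); first by have [_|_] := leP y z; lra.
  by lra.
rewrite (le_trans _ m3)// (_ : m ^+ 3 = m * m * m); last by ring.
by apply: ler_pM => //; [exact: mulr_ge0|exact: ler_pM].
Qed.

(** theta'^q (theta / theta')^j is dominated by powers of theta, theta' and
    1 / theta' separately. *)
Lemma integrable_theta_moments i j :
  integrableR pi (fun w => theta_weight w * `|theta_lin w| ^+ i * `|theta_quad w| ^+ j).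
Proof.
pose m := (Num.truncn q).+1.
pose g (w : W) : R :=
  ((1 + `|w.2.2| ^+ (3 * m)) * 4 + `|w.1.2| ^+ (3 * j)) + (`|w.2.2|^-1) ^+ (3 * j).
have mt1 : measurable_fun setT (fun w : W => `|w.1.2|) by apply: measurableT_comp
  => //; exact: measurable_theta1.
have mt2 : measurable_fun setT (fun w : W => `|w.2.2|) by apply: measurableT_comp
  => //; exact: measurable_theta2.
have mt3 : measurable_fun setT (fun w : W => `|w.2.2|^-1) by exact: measurable_funV_ge0.
apply: (integrableR_le (g := g)).
- apply: measurable_funM; [apply: measurable_funM; first exact: measurable_theta_weight|].
    by apply: measurable_funX; apply: measurableT_comp => //; exact: measurable_cst.
  by apply: measurable_funX; apply: measurableT_comp => //; exact: measurable_theta_quad.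
- move=> w; rewrite ger0_norm; last first.
    by apply: mulr_ge0; [apply: mulr_ge0;
      [exact: theta_weight_ge0|exact: exprn_ge0]|exact: exprn_ge0].
  have g0 : 0 <= g w by rewrite !addr_ge0 ?mulr_ge0 ?addr_ge0 ?exprn_ge0 ?invr_ge0.
  case: i => [|i]; last by rewrite /theta_lin normr0 expr0n/= mulr0 mul0r.
  rewrite expr0 mulr1 /theta_weight /theta_quad normrN normrM normr_id normfV normr_id.
  set x := `|w.2.2|; have x0 : 0 <= x by exact: normr_ge0.
  have H : \1_good_pair w * x `^ q <= 1 + x ^+ m.
    rewrite indicE; case: (w \in _); last by rewrite mul0r addr_ge0// exprn_ge0.
    rewrite mul1r; have [x1|x1] := leP x 1.
      have q0 : 0 <= q by rewrite divr_ge0 ?(le_trans (ler0n R 2) p2).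
      apply: (@le_trans _ _ 1); last by rewrite lerDl exprn_ge0.
      by have := @ge0_ler_powR R q q0 x 1; rewrite !nnegrE powR1; apply.
    rewrite ler_wpDl// -powR_mulrn// ler_powR ?(ltW x1)//.
    by rewrite ltW// /m truncnS_gt.
  rewrite exprMn mulrA.
  rewrite (@le_trans _ _ ((1 + x ^+ m) * `|w.1.2| ^+ j * x^-1 ^+ j))//.
    by rewrite !ler_wpM2r ?exprn_ge0 ?invr_ge0.
  rewrite (le_trans (prod3_le _ _ _)) ?addr_ge0 ?exprn_ge0 ?invr_ge0//.
  rewrite /g -/x -!exprM ![(j * 3)%N]mulnC !lerD2r [(3 * m)%N]mulnC exprM.
  have y0 : 0 <= x ^+ m by rewrite exprn_ge0.
  move: (x ^+ m) y0 => y y0.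
  (* (1 + y)^3 <= 4 (1 + y^3) is 3 (1 + y) (1 - y)^2 >= 0. *)
  have : 0 <= (1 + y) * (1 - y) ^+ 2 by rewrite mulr_ge0 ?sqr_ge0// addr_ge0.
  by rewrite !exprS expr0; nra.
- apply: integrableRD; last exact: fast_tail_moment.
  apply: integrableRD; last exact: fast_tail_moment.
  rewrite (_ : (fun w => _) = (fun w : W => 4 * (1 + `|w.2.2| ^+ (3 * m)))); last first.
    by apply/funext => w; rewrite mulrC.
  apply: integrableRZ; apply: integrableRD; first exact: integrableR_cst.
  exact: fast_tail_moment.
Qed.

End coupling.

(** * The expansion of the transport cost *)

Section transport_expansion.
Local Open Scope complex_scope.
Context {R : realType}.
Variable pi : probability ((borelC R * R) * (borelC R * R))%type R.
Variables (p r rho : R).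
Hypotheses (p2 : 2 <= p) (r0 : 0 < r) (rho0 : 0 < rho).

Notation W := ((borelC R * R) * (borelC R * R))%type.
Notation good := (good_pair r rho).
Notation xi_weight := (xi_weight p r rho).
Notation theta_weight := (theta_weight p r rho).

Hypothesis G0 : pi (~` good) = 0%E.
Hypotheses (ft1 : fast_tail pi (fun w => `|w.1.2|))
  (ft2 : fast_tail pi (fun w => `|w.2.2|))
  (ft3 : fast_tail pi (fun w => `|w.2.2|^-1)).

Let q := p / 2.

Let p0 : 0 <= p. Proof. exact: le_trans (ler0n R 2) p2. Qed.
Let q0 : 0 <= q. Proof. by rewrite divr_ge0. Qed.

(** The summands of the scaled cost. *)
Let xi_cost e (w : W) := xi_weight w * `|1 + (xi_lin w * e + xi_quad w * e ^+ 2)| `^ q.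
Let theta_cost e (w : W) :=
  theta_weight w * `|1 + (theta_lin w * e + theta_quad w * e ^+ 2)| `^ q.
(** The integrand of the transport cost, for lambda = l. *)
Let cost l (w : W) := Normc.normc ((w.1.1 : R[i]) - l%:C * w.2.1) `^ p
                      + `|w.1.2 - l ^+ 2 * w.2.2| `^ q.

(** The cost is homogeneous: the factor lambda^p is taken out. *)
Lemma cost_good l w : 0 < l -> good w ->
  cost l w = l `^ p * (xi_cost l^-1 w + theta_cost l^-1 w).
Proof.
move=> l0 wG; have [[/= rx xrho th0] [/= ry yrho th0']] := wG.
have ny0 : 0 < Normc.normc w.2.1 by rewrite (lt_le_trans r0).
have nyge0 : 0 <= Normc.normc w.2.1 by exact: ltW.
rewrite /cost mulrDr /xi_cost /theta_cost /xi_weight /theta_weight indicE mem_set//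
  !mul1r; congr (_ + _).
  rewrite -sqr_powR_half ?normc_nonneg// normc_subZ_sqr.
  rewrite -(sqr_powR_half _ (ltW l0)) -(sqr_powR_half _ (ltW ny0)) -!powRM ?sqr_ge0//
    ?mulr_ge0 ?sqr_ge0//.
  rewrite -/q; congr (_ `^ _).
  set v := 1 + _.
  have vE : Normc.normc w.1.1 ^+ 2 - 2 * l * cdot (w.2.1 : R[i]) w.1.1 +
      l ^+ 2 * Normc.normc w.2.1 ^+ 2 = (l ^+ 2 * Normc.normc w.2.1 ^+ 2) * v.
    by rewrite /v /xi_lin /xi_quad; field; rewrite !gt_eqF.
  have v0 : 0 <= v.
    have c0 : 0 < l ^+ 2 * Normc.normc w.2.1 ^+ 2 by rewrite mulr_gt0 ?exprn_gt0.
    by rewrite -(pmulr_rge0 _ c0) -vE -normc_subZ_sqr sqr_ge0.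
  by rewrite vE (ger0_norm v0) mulrA.
rewrite -(sqr_powR_half _ (ltW l0)) -/q -!powRM ?sqr_ge0// ?mulr_ge0//.
congr (_ `^ _); set v := 1 + _.
have -> : w.1.2 - l ^+ 2 * w.2.2 = - (l ^+ 2 * (w.2.2 * v)).
  rewrite /v /theta_lin /theta_quad !gtr0_norm//; field; by rewrite !gt_eqF.
by rewrite normrN !normrM (ger0_norm (ltW l0)).
Qed.

Lemma measurable_cost l : measurable_fun setT (cost l).
Proof.
apply: measurable_funD.
  rewrite (_ : (fun w => _) = (fun w : W =>
     (Normc.normc w.1.1 ^+ 2 - 2 * l * cdot (w.2.1 : R[i]) w.1.1 + l ^+ 2 * Normc.normc
       w.2.1 ^+ 2) `^ q)).
    apply: (measurableT_comp (measurable_powR q)); apply: measurable_funD.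
      apply: measurable_funB; first by apply: measurable_funX; exact: measurable_norm_xi1.
      by apply: measurable_funM => //; exact: measurable_dot_xi.
    by apply: measurable_funM => //; apply: measurable_funX; exact: measurable_norm_xi2.
  by apply/funext => w; rewrite -normc_subZ_sqr sqr_powR_half// normc_nonneg.
apply: (measurableT_comp (measurable_powR q)); apply: measurableT_comp => //.
apply: measurable_funB; first exact: measurable_theta1.
by apply: measurable_funM => //; exact: measurable_theta2.
Qed.

Lemma xi_cost_taylor n : exists2 C : R, 0 <= C & forall e, 0 <= e <= 1 ->
   integrableR pi (xi_cost e) /\ `| \int[pi]_w xi_cost e w
      - (moment_expansion pi xi_weight (@xi_lin R) (@xi_quad R) q n).[e] | <= C * e ^+ n.
Proof.
apply: expectation_taylor => //.
- exact: xi_weight_ge0.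
- exact: measurable_xi_weight.
- exact: measurable_xi_lin.
- exact: measurable_xi_quad.
- exact: integrable_xi_moments.
Qed.

Lemma theta_cost_taylor n : exists2 C : R, 0 <= C & forall e, 0 <= e <= 1 ->
   integrableR pi (theta_cost e) /\ `| \int[pi]_w theta_cost e w
      - (moment_expansion pi theta_weight (@theta_lin R) (@theta_quad R) q n).[e] | <=
        C * e ^+ n.
Proof.
apply: expectation_taylor => //.
- exact: theta_weight_ge0.
- exact: measurable_theta_weight.
- exact: measurable_cst.
- exact: measurable_theta_quad.
- exact: integrable_theta_moments.
Qed.

(** The function F of e = 1 / lambda such that T_p = lambda F(e)^(1/p). *)
Definition scaled_cost e := \int[pi]_w xi_cost e w + \int[pi]_w theta_cost e w.

Lemma integral_good_pair (f g : W -> R) : measurable_fun setT f -> measurable_fun setT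
  g ->
  (forall w, good w -> f w = g w) ->
  (\int[pi]_w (f w)%:E = \int[pi]_w (g w)%:E)%E.
Proof.
move=> mf mg fg; apply: ae_eq_integral => //; try exact/measurable_EFinP.
exists (~` good); split => //; first by apply: measurableC; exact: measurable_good_pair.
by move=> w /= h wG; apply: h => _; rewrite fg.
Qed.

Lemma transportE l : 1 <= l -> transport pi p l = l * scaled_cost l^-1 `^ p^-1.
Proof.
move=> l1; have l0 : 0 < l by rewrite (lt_le_trans _ l1).
have [_ _ /(_ l^-1)[|i1 _]] := xi_cost_taylor 0; first
  by rewrite invr_ge0 (ltW l0) invf_le1.
have [_ _ /(_ l^-1)[|i2 _]] := theta_cost_taylor 0; first
  by rewrite invr_ge0 (ltW l0) invf_le1.
have pp : p != 0 by rewrite gt_eqF// (lt_le_trans _ p2).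
rewrite /transport.
have -> : fine 'E_pi[fun w => cost l w] = l `^ p * scaled_cost l^-1.
  rewrite unlock (@integral_good_pair _ (fun w
    => l `^ p * (xi_cost l^-1 w + theta_cost l^-1 w))).
  - rewrite -/(Rintegral _ _ _) RintegralZl//; last exact: integrableRD.
    by rewrite RintegralD.
  - exact: measurable_cost.
  - apply: measurable_funM => //; apply: measurable_funD.
      by apply/measurable_EFinP; exact: (measurable_int _ i1).
    by apply/measurable_EFinP; exact: (measurable_int _ i2).
  - by move=> w; exact: cost_good.
rewrite powRM ?powR_ge0//; last first.
  rewrite addr_ge0// Rintegral_ge0// => w _;
    rewrite mulr_ge0 ?powR_ge0 ?xi_weight_ge0 ?theta_weight_ge0//.
by rewrite -powRrM divff// powRr1// ltW.
Qed.

(** The expansion of scaled_cost up to order n. *)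
Definition scaled_cost_poly n :=
  moment_expansion pi xi_weight (@xi_lin R) (@xi_quad R) q n
  + moment_expansion pi theta_weight (@theta_lin R) (@theta_quad R) q n.

Lemma expands_scaled_cost n : expands n scaled_cost (scaled_cost_poly n).
Proof.
apply: expandsD.
  apply: expands_expectation => //.
  - exact: xi_weight_ge0.
  - exact: measurable_xi_weight.
  - exact: measurable_xi_lin.
  - exact: measurable_xi_quad.
  - exact: integrable_xi_moments.
apply: expands_expectation => //.
- exact: theta_weight_ge0.
- exact: measurable_theta_weight.
- exact: measurable_cst.
- exact: measurable_theta_quad.
- exact: integrable_theta_moments.
Qed.

(** The constant S_p, computed on the second marginal of the coupling. *)
Definition coupling_moment : R := fine (\int[pi]_w (Normc.normc w.2.1 `^ p)%:E
        + \int[pi]_w (`|w.2.2| `^ q)%:E)%E.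

Lemma scaled_cost_poly0 n : (0 < n)%N -> (scaled_cost_poly n)`_0 = coupling_moment.
Proof.
move=> n0; rewrite coefD !moment_expansion0// /coupling_moment.
have i1 : integrableR pi xi_weight.
  have := integrable_xi_moments pi p2 r0 rho0 0 0.
  by rewrite (_ : (fun w => _) = xi_weight)//; apply/funext => w; rewrite !expr0 !mulr1.
have i2 : integrableR pi theta_weight.
  have := integrable_theta_moments r rho p2 ft1 ft2 ft3 0 0.
  by rewrite (_ : (fun w => _) = theta_weight)//; apply/funext => w;
    rewrite !expr0 !mulr1.
rewrite (@integral_good_pair _ xi_weight); last first.
  by move=> w wG; rewrite /xi_weight indicE mem_set// mul1r.
- exact: measurable_xi_weight.
- exact: (measurableT_comp (measurable_powR p) (@measurable_norm_xi2 R)).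
rewrite (@integral_good_pair (fun w => `|w.2.2| `^ q) theta_weight); last first.
  by move=> w wG; rewrite /theta_weight indicE mem_set// mul1r.
- exact: measurable_theta_weight.
- apply: (measurableT_comp (measurable_powR q)).
  by apply: measurableT_comp => //; exact: measurable_theta2.
rewrite fineD//; exact: integrable_fin_num.
Qed.

Lemma scaled_cost_poly1 n : (1 < n)%N -> (scaled_cost_poly n)`_1 =
  - (p * correlation pi p).
Proof.
move=> n1; rewrite coefD !moment_expansion1//.
rewrite (_ : \int[pi]_w (theta_weight w * theta_lin w) = 0); last first.
  rewrite /Rintegral (eq_integral (fun=> 0%E)) ?integral0// => w _.
  by rewrite /theta_lin mulr0.
rewrite mulr0 addr0.
have := integrable_moment (@xi_weight_ge0 _ p r rho) (@measurable_xi_weight _ p r rho)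
  (@measurable_xi_lin R) (@measurable_xi_quad R)
   (integrable_xi_moments pi p2 r0 rho0) 1 0.
rewrite (_ : (fun w => _) = (fun w => xi_weight w * xi_lin w)); last first.
  by apply/funext => w; rewrite expr0 expr1 mulr1.
move=> i1.
suff -> : correlation pi p = \int[pi]_w (- 2^-1 * (xi_weight w * xi_lin w)).
  by rewrite RintegralZl// /q; field.
rewrite /correlation unlock; congr fine; apply: integral_good_pair.
- apply: measurable_funM; last exact: measurable_dot_xi.
  exact: (measurableT_comp (measurable_powR _) (@measurable_norm_xi2 R)).
- apply: measurable_funM => //; apply: measurable_funM.
    exact: measurable_xi_weight.
  exact: measurable_xi_lin.
- move=> w wG; have [_ [/= ry yrho th0']] := wG.
  have ny0 : 0 < Normc.normc w.2.1 by rewrite (lt_le_trans r0).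
  rewrite /xi_weight /xi_lin indicE mem_set// mul1r powRB; last by apply/implyP => _;
    rewrite gt_eqF.
  rewrite powR_mulrn ?(ltW ny0)//; field.
  by rewrite gt_eqF.
Qed.

Lemma coupling_moment_gt0 : 0 < coupling_moment.
Proof.
have -> : coupling_moment = \int[pi]_w xi_weight w + \int[pi]_w theta_weight w.
  by rewrite -(scaled_cost_poly0 (ltn0Sn 0)) coefD !moment_expansion0.
have i1 : integrableR pi xi_weight.
  have := integrable_xi_moments pi p2 r0 rho0 0 0.
  by rewrite (_ : (fun w => _) = xi_weight)//; apply/funext => w; rewrite !expr0 !mulr1.
apply: ltr_wpDr; first by apply: Rintegral_ge0 => w _; exact: theta_weight_ge0.
have mG := @measurable_good_pair R r rho.
have G1 : pi good = 1%E.
  by rewrite -[good]setCK probability_setC ?G0 ?sube0//; exact: measurableC.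
have rp : 0 < r `^ p by rewrite powR_gt0.
apply: (@lt_le_trans _ _ (\int[pi]_w (r `^ p * \1_good w))).
  rewrite RintegralZl//; last exact: integrable_indic.
  rewrite /Rintegral integral_indic// setIT (_ : fine _ = 1) ?mulr1//;
    exact: (congr1 fine G1).
apply: le_Rintegral => //.
  by apply: integrableRZ; exact: integrable_indic.
move=> w _; rewrite /xi_weight mulrC indicE; have [wG|_] := boolP (w \in good); last
  by rewrite !mul0r.
rewrite !mul1r; move: wG; rewrite inE => -[_ [/= ry _ _]].
by apply: (ge0_ler_powR p0) => //; rewrite nnegrE ?normc_nonneg ?ltW.
Qed.

(** What holds near 0+ holds near +oo for the inverse variable. *)
Lemma near_pinfty_inv (Q : R -> Prop) : (\forall e \near 0^'+, Q e) ->
  \forall l \near +oo, Q l^-1.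
Proof.
move=> /nbhs_ballP[d /= d0 hd]; near=> l.
have l0 : 0 < l by near: l; apply: nbhs_pinfty_gt; rewrite num_real.
apply: hd; rewrite ?invr_gt0// /ball/= sub0r normrN gtr0_norm ?invr_gt0//.
rewrite invf_plt ?posrE//; near: l; apply: nbhs_pinfty_gt; rewrite num_real//.
Unshelve. all: by end_near. Qed.

(** The theorem for an arbitrary coupling of laws that have the properties of the
    exit law: position between two circles, fast tails of the time and of its
    inverse. *)
Theorem transport_expansion : exists b : nat -> R,
    [/\ forall N : nat,
          bigO_pinfty
            (fun lambda => transport pi p lambda
               - (lambda * coupling_moment `^ p^-1 + b 0%N
                  + \sum_(1 <= j < N.+1) b j * lambda ^- j))
            (fun lambda => lambda ^- N.+1),
        b 0%N = - (correlation pi p / coupling_moment `^ ((p - 1) / p))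
      & bigO_pinfty
          (fun lambda => transport pi p lambda
             - (lambda * coupling_moment `^ p^-1
                - correlation pi p / coupling_moment `^ ((p - 1) / p)))
          (fun lambda => lambda^-1)].
Proof.
have S0 := coupling_moment_gt0.
have pn0 : p != 0 by rewrite gt_eqF// (lt_le_trans _ p2).
pose G e := scaled_cost e `^ p^-1.
pose Q n := coupling_moment `^ p^-1 *: (binpoly p^-1 n \Po (coupling_moment^-1 *:
  scaled_cost_poly n - 1)).
have Gex n : expands n.+1 G (Q n.+1).
  have := @expands_powR R n p^-1 scaled_cost (scaled_cost_poly n.+1)
    (expands_scaled_cost _).
  by rewrite scaled_cost_poly0//; apply.
have [c hc] : exists c : nat -> R, forall n, expands n G (\poly_(k < n) c k).
  apply: expands_coefs => n; exists (Q n.+1).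
  exact: expands_le (Gex n).
(* Modulo e^2, only the first two terms of the binomial series matter. *)
have G2 : Q 2 = coupling_moment `^ p^-1 *: 1 +
    (coupling_moment `^ p^-1 / p) *: (coupling_moment^-1 *: scaled_cost_poly 2 - 1).
  rewrite /Q /binpoly poly_def !big_ord_recr big_ord0/= add0r.
  rewrite comp_polyD !comp_polyZ !comp_Xn_poly expr0 expr1 scalerDr !scalerA mulr1.
  by rewrite divr1 mulr1.
have c0E : c 0%N = coupling_moment `^ p^-1.
  have := expands_uniq (hc 2) (Gex 1%N) (ltn0Sn 1); rewrite G2 coef_poly/= => ->.
  rewrite coefD !coefZ coefB coefZ !coef1 scaled_cost_poly0//= mulVf ?gt_eqF//.
  by rewrite subrr mulr0 mulr1 addr0.
have c1E : c 1%N = - (correlation pi p / coupling_moment `^ ((p - 1) / p)).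
  have := expands_uniq (hc 2) (Gex 1%N) (leqnn 2); rewrite G2 coef_poly/= => ->.
  rewrite coefD !coefZ coefB coefZ !coef1 scaled_cost_poly1//= mulr0 add0r subr0.
  have -> : (p - 1) / p = 1 - p^-1 by rewrite mulrBl divff// mul1r.
  rewrite powRB; last by apply/implyP => _; rewrite gt_eqF.
  rewrite powRr1 ?(ltW S0)//.
  have : coupling_moment `^ p^-1 != 0 by rewrite gt_eqF// powR_gt0.
  move: (coupling_moment `^ p^-1) => u u0; field.
  by rewrite u0 pn0 gt_eqF.
pose b j := c j.+1.
have main N : bigO_pinfty
            (fun lambda => transport pi p lambda
               - (lambda * coupling_moment `^ p^-1 + b 0%N
                  + \sum_(1 <= j < N.+1) b j * lambda ^- j))
            (fun lambda => lambda ^- N.+1).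
  have [C C0 /near_pinfty_inv hC] := hc N.+2.
  exists C; near=> l.
  have l1 : 1 <= l by near: l; apply: nbhs_pinfty_ge; rewrite num_real.
  have l0 : 0 < l by rewrite (lt_le_trans _ l1).
  rewrite transportE// -/(G l^-1) -c0E.
  have Gl : `|G l^-1 - (\poly_(k < N.+2) c k).[l^-1]| <= C * l^-1 ^+ N.+2 by near: l.
  have -> : l * c 0%N + b 0%N + \sum_(1 <= j < N.+1) b j * l ^- j =
     l * (\poly_(k < N.+2) c k).[l^-1].
    rewrite horner_poly 2!big_ord_recl/= expr0 mulr1 expr1 !mulrDr addrA.
    congr (_ + _); first by congr (_ + _); rewrite /b mulrCA divff ?gt_eqF// mulr1.
    rewrite big_add1 big_mkord mulr_sumr; apply: eq_bigr => k _.
    rewrite /b /bump/= !add1n exprVn (exprS l k.+1).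
    move: (l ^+ k.+1) (expf_neq0 k.+1 (lt0r_neq0 l0)) => t t0; field.
    by rewrite t0 gt_eqF.
  have lN : 0 <= l ^- N.+1 by rewrite invr_ge0 exprn_ge0// ltW.
  rewrite -mulrBr normrM (gtr0_norm l0) (ger0_norm lN).
  rewrite (le_trans (ler_wpM2l (ltW l0) Gl))// mulrCA exprS [l * (l^-1 * _)]mulrA.
  by rewrite divff ?gt_eqF// mul1r exprVn.
exists b; split => //.
have := main 0%N; rewrite /b c1E => -[C hC]; exists C; near=> l.
have : `|transport pi p l - (l * coupling_moment `^ p^-1 + - (correlation pi p /
  coupling_moment `^ ((p - 1) / p))
        + \sum_(1 <= j < 1) c j.+1 * l ^- j)| <= C * `|l ^- 1| by near: l.
by rewrite big_geq// addr0 expr1.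
Unshelve. all: by end_near. Qed.

End transport_expansion.

(** * Transfer to couplings of the exit law *)

Section marginals.
Context {R : realType} {d : measure_display} {T : measurableType d}.
Variables (P : probability T R) (d' : measure_display) (S : measurableType d')
  (E : T -> S) (mE : measurable_fun setT E).
Variables (d'' : measure_display) (W : measurableType d'') (pi : probability W R)
  (f : W -> S) (mf : measurable_fun setT f).
Hypothesis same_law : forall A, measurable A -> pushforward pi f A = pushforward P E A.

(** Random elements f and E with the same law have the same expectations. *)
Lemma ge0_integral_same_law (g : S -> R) : measurable_fun setT g ->
  (forall z, 0 <= g z) ->
  (\int[P]_w (g (E w))%:E = \int[pi]_w (g (f w))%:E)%E.
Proof.
move=> mg g0; have mg' : measurable_fun setT (EFin \o g) by exact/measurable_EFinP.
have g0' : {in setT, forall y, (0 <= (EFin \o g) y)%E} by move=> y _; rewrite lee_fin.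
have := ge0_integral_pushforward mf pi measurableT mg' g0'.
have := ge0_integral_pushforward mE P measurableT mg' g0'.
rewrite !preimage_setT => /= <- <-.
by apply: eq_measure_integral => A mA _; exact: esym (same_law mA).
Qed.

Lemma fast_tail_same_law (g : S -> R) : measurable_fun setT g ->
  fast_tail P (fun w => g (E w)) -> fast_tail pi (fun w => g (f w)).
Proof.
move=> mg ft m; have [K K0 hK] := ft m; exists K => // x x1.
have mA : measurable [set z | x <= g z] by exact: measurable_ge.
by have := same_law mA; rewrite /pushforward /preimage/= => ->; exact: hK.
Qed.

End marginals.

Theorem theorem15 (R : realType) (d : measure_display) (T : measurableType d)
    (P : probability T R) (Z : R -> T -> R[i]) (hZ : planar_BM P Z)
    (p : R) (hp : 2 <= p)
    (U : set R[i]) (domU : domain U) (bndU : bounded_set U) (U0 : U 0)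
    (pi : probability ((borelC R * R) * (borelC R * R))%type R)
    (hpi : couplings (exit_law P Z U) (exit_law P Z U) pi) :
  let S := exit_moment P Z U p in
  exists b : nat -> R,
    [/\ forall N : nat,
          bigO_pinfty
            (fun lambda => transport pi p lambda
               - (lambda * S `^ p^-1 + b 0%N
                  + \sum_(1 <= j < N.+1) b j * lambda ^- j))
            (fun lambda => lambda ^- N.+1),
        b 0%N = - (correlation pi p / S `^ ((p - 1) / p))
      & bigO_pinfty
          (fun lambda => transport pi p lambda
             - (lambda * S `^ p^-1 - correlation pi p / S `^ ((p - 1) / p)))
          (fun lambda => lambda^-1)].
Proof.
have [_ _ oU _] := domU.
have [mE [[r [rho [r0 rho0 bad0]]] [ft1 ft2 E0]]] := exit_pair_properties hZ oU bndU U0.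
have [law1 law2] := hpi.
have mgood := @measurable_good_exit R r rho.
have G0 : pi (~` good_pair r rho) = 0%E.
  have bad1 : (pi (fst @^-1` (~` good_exit r rho)) <= 0)%E.
    by have := law1 _ (measurableC mgood); rewrite /pushforward => ->;
      rewrite [leLHS]bad0.
  have bad2 : (pi (snd @^-1` (~` good_exit r rho)) <= 0)%E.
    by have := law2 _ (measurableC mgood); rewrite /pushforward => ->;
      rewrite [leLHS]bad0.
  rewrite /good_pair setCI !preimage_setC; apply/eqP; rewrite eq_le measure_ge0 andbT.
  apply: (le_trans (measureU2 _ _ _)).
  - by rewrite -[X in measurable X]setTI; apply: measurable_fst => //; exact: measurableC.
  - by rewrite -[X in measurable X]setTI; apply: measurable_snd => //; exact: measurableC.
  - rewrite -[leRHS]adde0.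
    exact: leeD bad1 bad2.
have mt : measurable_fun setT (fun z : borelC R * R => `|z.2|).
  by apply: measurableT_comp => //; exact: measurable_snd.
have mti : measurable_fun setT (fun z : borelC R * R => `|z.2|^-1)
  by exact: measurable_funV_ge0.
(* The time is nonnegative as a function on the probability space but not as a
   coordinate on the product space, hence the absolute values. *)
have ftE : fast_tail P (fun w => `|(exit_pair Z U w).2|).
  by rewrite (_ : (fun w => _) = (fun w => (exit_pair Z U w).2))//; apply/funext => w;
    rewrite ger0_norm.
have ftEV : fast_tail P (fun w => `|(exit_pair Z U w).2|^-1).
  by rewrite (_ : (fun w => _) = (fun w => (exit_pair Z U w).2^-1))//; apply/funext
    => w; rewrite ger0_norm.
have := transport_expansion hp r0 rho0 G0
  (fast_tail_same_law (f := fst) law1 mt ftE)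
  (fast_tail_same_law (f := snd) law2 mt ftE)
  (fast_tail_same_law (f := snd) law2 mti ftEV).
suff -> : coupling_moment pi p = exit_moment P Z U p by [].
rewrite /coupling_moment /exit_moment unlock; congr (fine (_ + _)%E).
  rewrite (@ge0_integral_same_law _ _ _ P _ _ _ mE _ _ pi snd measurable_snd law2
     (fun z => Normc.normc z.1 `^ p))// => [|z]; last exact: powR_ge0.
  apply: (measurableT_comp (measurable_powR p)).
  exact: measurableT_comp measurable_normc measurable_fst.
rewrite (_ : (fun w => _) = (fun w => (`|(exit_pair Z U w).2| `^ (p / 2))%:E));
  last first.
  by apply/funext => w; rewrite ger0_norm.
rewrite (@ge0_integral_same_law _ _ _ P _ _ _ mE _ _ pi snd measurable_snd law2
   (fun z => `|z.2| `^ (p / 2)))//.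
exact: (measurableT_comp (measurable_powR _) mt).
Qed.
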